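(* Let $f:\mathbb{R}^d\to\mathbb{R}$ be a quadratic function with constant Hessian $H$, $L$-smooth and $\sigma$-strongly convex. Let $(\Sigma_k)_{k\ge1}$ be generated by the algorithm MiNES (with batch size $b=1$) with step sizes $\eta_2^{(k)}=\frac1k$. Then for all $k\ge1$, $$\mathbb{E}\left[\left\|\Sigma_k^{-1}-\Pi_{\mathcal{S}'}(H)\right\|^2\right]\le\frac1k\cdot\max\left\{\left\|\Sigma_1^{-1}-H\right\|^2,\ M\right\},$$ where $$M=\frac{L^2\zeta^2}{4\tau^2}\left(d^4+11d^3+34d^2+32d\right)+2d\zeta^2+\|H\|^2 .$$
   Context: Norms on matrices are Frobenius norms. Constants $\alpha>0$ and $0<\tau\le\zeta$ are fixed. $\mathcal{S}=\{\Sigma \text{ symmetric } d\times d:\ \zeta^{-1}I\preceq\Sigma\preceq\tau^{-1}I\}$ and $\mathcal{S}'=\{\Sigma^{-1}:\Sigma\in\mathcal{S}\}$; $\Pi_{\mathcal{S}'}(A)=\operatorname*{arg\,min}_{X\in\mathcal{S}'}\|A-X\|$ for symmetric $A$. $L$-smooth means $\nabla f$ is $L$-Lipschitz; $\sigma$-strongly convex means $f(x)-f(y)\ge\langle\nabla f(y),x-y\rangle+\frac{\sigma}{2}\|x-y\|^2$ for all $x,y$. (So $\sigma I\preceq H\preceq LI$.) MiNES with $b=1$: start from deterministic $\mu_1\in\mathbb{R}^d$ and $\Sigma_1\in\mathcal{S}$. At iteration $k=1,2,\dots$ draw $u_k\sim N(0,I_d)$ independently of the past and set $$\tilde g(\mu_k)=\frac{f(\mu_k+\alpha\Sigma_k^{1/2}u_k)-f(\mu_k-\alpha\Sigma_k^{1/2}u_k)}{2\alpha}\,\Sigma_k^{1/2}u_k,$$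 $$\tilde G(\Sigma_k)=\frac{1}{2\alpha^2}\left(f(\mu_k-\alpha\Sigma_k^{1/2}u_k)+f(\mu_k+\alpha\Sigma_k^{1/2}u_k)-2f(\mu_k)\right)\left(\Sigma_k^{-1/2}u_ku_k^\top\Sigma_k^{-1/2}-\Sigma_k^{-1}\right)-\Sigma_k^{-1},$$ $$\mu_{k+1}=\mu_k-\eta_1^{(k)}\tilde g(\mu_k),\qquad \Sigma_{k+1}^{-1}=\Pi_{\mathcal{S}'}\left(\Sigma_k^{-1}+\eta_2^{(k)}\tilde G(\Sigma_k)\right),$$ with step sizes $\eta_1^{(k)},\eta_2^{(k)}>0$. *)

(* Defs.v *)
From HB Require Import structures.
From mathcomp Require Import all_boot all_order all_algebra.
From mathcomp Require Import all_classical all_reals all_analysis.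
Set Implicit Arguments.
Unset Strict Implicit.
Unset Printing Implicit Defensive.
Import Order.TTheory GRing.Theory Num.Theory.
Import numFieldNormedType.Exports.
Local Open Scope classical_set_scope.
Local Open Scope ring_scope.

(* The library norm `|A| on matrices is the max norm, hence this definition.
   On column vectors it is the Euclidean norm. *)
Definition frobenius {R : realType} {m n : nat} (A : 'M[R]_(m, n)) : R :=
  Num.sqrt (\sum_i \sum_j A i j ^+ 2).

Definition dotv {R : realType} {d : nat} (x y : 'cV[R]_d) : R :=
  (x^T *m y) ord0 ord0.

Definition gradient {R : realType} {d : nat} (f : 'cV[R]_d -> R) (x : 'cV[R]_d)
    : 'cV[R]_d :=
  \col_i 'D_(delta_mx i ord0) f x.

Definition hessian {R : realType} {d : nat} (f : 'cV[R]_d -> R) (x : 'cV[R]_d)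
    : 'M[R]_d :=
  \matrix_(i, j) 'D_(delta_mx i ord0) (fun y => gradient f y j ord0) x.

Definition quadratic {R : realType} {d : nat} (f : 'cV[R]_d -> R) : Prop :=
  exists (A : 'M[R]_d) (b : 'cV[R]_d) (c : R),
    forall x, f x = dotv x (A *m x) + dotv b x + c.

Definition lsmooth {R : realType} {d : nat} (L : R) (f : 'cV[R]_d -> R) : Prop :=
  (forall x, differentiable f x) /\
  forall x y, frobenius (gradient f x - gradient f y) <= L * frobenius (x - y).

Definition strongly_convex {R : realType} {d : nat} (sigma : R)
    (f : 'cV[R]_d -> R) : Prop :=
  forall x y,
    f x - f y >=
      dotv (gradient f y) (x - y) + sigma / 2 * frobenius (x - y) ^+ 2.

(* Loewner order; it is only used between symmetric matrices. *)
Definition loewner_le {R : realType} {d : nat} (A B : 'M[R]_d) : Prop :=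
  forall x : 'cV[R]_d, 0 <= dotv x ((B - A) *m x).

(* The positive semidefinite square root; the default value 0 of [xget] is
   irrelevant on positive semidefinite A, where the root exists uniquely. *)
Definition sqrtmx {R : realType} {d : nat} (A : 'M[R]_d) : 'M[R]_d :=
  xget 0 [set B : 'M[R]_d | [/\ B^T = B, loewner_le 0 B & B *m B = A]].

Definition covset {R : realType} {d : nat} (tau zeta : R) : set 'M[R]_d :=
  [set A : 'M[R]_d | [/\ A^T = A, loewner_le (zeta^-1)%:M A
                       & loewner_le A (tau^-1)%:M]].

Definition precset {R : realType} {d : nat} (tau zeta : R) : set 'M[R]_d :=
  [set invmx A | A in covset tau zeta].

(* The default value 0 of [xget] is irrelevant: when 0 < tau <= zeta, the set
   is nonempty, compact and convex, so the minimizer exists uniquely. *)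
Definition proj_prec {R : realType} {d : nat} (tau zeta : R) (A : 'M[R]_d)
    : 'M[R]_d :=
  xget 0 [set X : 'M[R]_d | precset tau zeta X /\
    forall Y, precset tau zeta Y -> frobenius (A - X) <= frobenius (A - Y)].

Definition mines_g {R : realType} {d : nat} (alpha : R) (f : 'cV[R]_d -> R)
    (mu : 'cV[R]_d) (Sigma : 'M[R]_d) (u : 'cV[R]_d) : 'cV[R]_d :=
  let v := sqrtmx Sigma *m u in
  ((f (mu + alpha *: v) - f (mu - alpha *: v)) / (2 * alpha)) *: v.

Definition mines_G {R : realType} {d : nat} (alpha : R) (f : 'cV[R]_d -> R)
    (mu : 'cV[R]_d) (Sigma : 'M[R]_d) (u : 'cV[R]_d) : 'M[R]_d :=
  let v := sqrtmx Sigma *m u in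
  let Q := invmx (sqrtmx Sigma) in
  ((2 * alpha ^+ 2)^-1
     * (f (mu - alpha *: v) + f (mu + alpha *: v) - 2 * f mu))
    *: (Q *m u *m u^T *m Q - invmx Sigma)
  - invmx Sigma.

(* One trajectory of the algorithm with batch size 1, driven by the draws
   u 1, u 2, ...; index 0 is unused in all sequences. *)
Definition mines {R : realType} {d : nat} (alpha tau zeta : R)
    (f : 'cV[R]_d -> R) (eta1 eta2 : nat -> R)
    (mu1 : 'cV[R]_d) (Sigma1 : 'M[R]_d) (u : nat -> 'cV[R]_d)
    (mu : nat -> 'cV[R]_d) (Sigma : nat -> 'M[R]_d) : Prop :=
  [/\ mu 1%N = mu1, Sigma 1%N = Sigma1 &
    forall k, (1 <= k)%N ->
      mu k.+1 = mu k - eta1 k *: mines_g alpha f (mu k) (Sigma k) (u k) /\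
      invmx (Sigma k.+1) =
        proj_prec tau zeta
          (invmx (Sigma k)
             + eta2 k *: mines_G alpha f (mu k) (Sigma k) (u k))].

(* N(0, I_d) is the d-fold product of N(0, 1), and its law is determined by
   its values on measurable boxes. *)
Definition std_gaussian {R : realType} {dT : measure_display}
    {T : measurableType dT} (P : probability T R) {d : nat}
    (u : T -> 'cV[R]_d) : Prop :=
  (forall i, measurable_fun setT (fun w => u w i ord0)) /\
  forall B : 'I_d -> set R, (forall i, measurable (B i)) ->
    P [set w | forall i, B i (u w i ord0)] =
      (\prod_(i < d) normal_prob 0 1 (B i))%E.

Definition sigma_generated {R : realType} {dT : measure_display}
    {T : measurableType dT} {d : nat} (u : nat -> T -> 'cV[R]_d) (J : set nat)
    : set (set T) :=
  <<s \bigcup_(j in J) \bigcup_(i in [set: 'I_d])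
        preimage_set_system setT (fun w => u j w i ord0) measurable >>.

(* The initial point being deterministic, the past before step k is the
   sigma-algebra generated by u 1, ..., u (k - 1). *)
Definition indep_of_past {R : realType} {dT : measure_display}
    {T : measurableType dT} (P : probability T R) {d : nat}
    (u : nat -> T -> 'cV[R]_d) (k : nat) : Prop :=
  forall A B, sigma_generated u [set k] A ->
    sigma_generated u [set j | (1 <= j < k)%N] B ->
    P (A `&` B) = (P A * P B)%E.

(* Main.v *)
Require Import Defs.
From HB Require Import structures.
From mathcomp Require Import all_boot all_order all_algebra.
From mathcomp Require Import all_classical all_reals all_analysis.
From mathcomp Require Import measurable_realfun zify ring lra.
Import Order.TTheory GRing.Theory Num.Theory.
Import numFieldNormedType.Exports.
Local Open Scope classical_set_scope.
Local Open Scope ring_scope.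
Set Implicit Arguments.
Unset Strict Implicit.
Unset Printing Implicit Defensive.

(** Write X_k for the inverse of Sigma_k, S for the square root of Sigma_k and
Q for the inverse of S.  For a quadratic f the update direction is W - X_k with
W = 1/2 (u^T S H S u) Q (u u^T - I) Q, and Isserlis' formula for Gaussian fourth
moments gives E[W | past] = H.  The projection onto the convex set S' is
1-Lipschitz and makes an obtuse angle with S', so with P = Pi_S'(H)
  E|X_{k+1} - P|^2 <= (1 - 2 eta) E|X_k - P|^2 + eta^2 (E|W|^2 + |X_k|^2),
where E|W|^2 is controlled by the moments of |u|^2.  With eta = 1/k this closes
an induction from k = 2 on; in the step from k = 1 the factor is -1, and there
one uses instead that the squared diameter of S' is at most d zeta^2 <= M/2.

Conditional expectations are replaced by independence: <C, W> is a finite sum of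
bounded past-measurable coefficients times monomials in u_k, and the
expectation of each product factors.  Measurability of the coefficients holds
because projection, inversion and square root are Lipschitz on S'. *)

(** * Frobenius inner product and spectral bounds *)

(** The second difference of a quadratic does not depend on its base point, so mu_k drops out and
    X_k follows a recursion of its own, driven by u_k. The projection and the square root are given
    by a choice operator. Existence, uniqueness and measurability therefore have to be derived
    before the moment computation can begin. No eigenvalue is used: spectral bounds are inequalities
    between quadratic forms, and norms appear squared, through [fdot]. The contraction factor arises
    as follows. The terms linear in W are 2 eta <X - P, W> and, from |W - X|^2, also - 2 eta^2 <X,
    W>. Under the expectation W becomes H. Then <X - P, H - X> is at most - |X - P|^2, because <X -
    P, H - P> <= 0, and the other term has a favourable sign, because X and H are positive
    semidefinite. *)

Section InnerProduct.
Context {R : realType}.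

Definition fdot {m n : nat} (A B : 'M[R]_(m, n)) : R :=
  \sum_i \sum_j A i j * B i j.

Lemma fdot_tr m n (A B : 'M[R]_(m, n)) : fdot A B = \tr (A^T *m B).
Proof.
rewrite /fdot exchange_big; apply: eq_bigr => j _; rewrite mxE.
by apply: eq_bigr => i _; rewrite !mxE.
Qed.

Lemma frobenius_sqr m n (A : 'M[R]_(m, n)) : frobenius A ^+ 2 = fdot A A.
Proof.
rewrite /frobenius sqr_sqrtr; first by apply: eq_bigr => i _; apply: eq_bigr.
by apply: sumr_ge0 => i _; apply: sumr_ge0 => j _; exact: sqr_ge0.
Qed.

Lemma frobenius_ge0 m n (A : 'M[R]_(m, n)) : 0 <= frobenius A.
Proof. exact: sqrtr_ge0. Qed.

Lemma dotv_fdot d (x y : 'cV[R]_d) : dotv x y = fdot x y.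
Proof.
rewrite /dotv /fdot mxE; apply: eq_bigr => i _.
by rewrite big_ord1 mxE.
Qed.

Lemma fdotC m n (A B : 'M[R]_(m, n)) : fdot A B = fdot B A.
Proof. by apply: eq_bigr => i _; apply: eq_bigr => j _; rewrite mulrC. Qed.

Lemma fdotDr m n (A B C : 'M[R]_(m, n)) : fdot A (B + C) = fdot A B + fdot A C.
Proof. by rewrite !fdot_tr mulmxDr mxtraceD. Qed.

Lemma fdotDl m n (A B C : 'M[R]_(m, n)) : fdot (A + B) C = fdot A C + fdot B C.
Proof. by rewrite fdotC fdotDr !(fdotC C). Qed.

Lemma fdotZr m n a (A B : 'M[R]_(m, n)) : fdot A (a *: B) = a * fdot A B.
Proof. by rewrite !fdot_tr -scalemxAr mxtraceZ. Qed.

Lemma fdotZl m n a (A B : 'M[R]_(m, n)) : fdot (a *: A) B = a * fdot A B.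
Proof. by rewrite fdotC fdotZr fdotC. Qed.

Lemma fdotNr m n (A B : 'M[R]_(m, n)) : fdot A (- B) = - fdot A B.
Proof. by rewrite -scaleN1r fdotZr mulN1r. Qed.

Lemma fdotNl m n (A B : 'M[R]_(m, n)) : fdot (- A) B = - fdot A B.
Proof. by rewrite fdotC fdotNr fdotC. Qed.

Definition fdotE := (fdotDr, fdotDl, fdotZr, fdotZl, fdotNr, fdotNl).

Lemma fdot_ge0 m n (A : 'M[R]_(m, n)) : 0 <= fdot A A.
Proof. by rewrite -frobenius_sqr sqr_ge0. Qed.

Lemma fdot_eq0 m n (A : 'M[R]_(m, n)) : (fdot A A == 0) = (A == 0).
Proof.
apply/eqP/eqP => [A0|->]; last first.
  by rewrite /fdot big1// => i _; rewrite big1// => j _; rewrite mxE mul0r.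
apply/matrixP => i j; rewrite mxE; apply/eqP; rewrite -sqrf_eq0.
have rows0 : \sum_j A i j * A i j = 0.
  by apply: (psumr_eq0P _ A0) => // k _; apply: sumr_ge0 => l _; exact: sqr_ge0.
by rewrite expr2; apply/eqP/(psumr_eq0P _ rows0) => // l _; exact: sqr_ge0.
Qed.

Lemma entry_sqr_le_fdot m n (A : 'M[R]_(m, n)) i j : A i j ^+ 2 <= fdot A A.
Proof.
rewrite /fdot (bigD1 i)//= (bigD1 j)//= -expr2 -addrA lerDl addr_ge0//.
  by apply: sumr_ge0 => k _; exact: sqr_ge0.
by apply: sumr_ge0 => k _; apply: sumr_ge0 => l _; exact: sqr_ge0.
Qed.

Lemma fdot_mull m n p (A : 'M[R]_(m, n)) (B : 'M[R]_(n, p)) C :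
  fdot (A *m B) C = fdot B (A^T *m C).
Proof. by rewrite !fdot_tr trmx_mul mulmxA. Qed.

Lemma fdot_mulr m n p (A : 'M[R]_(m, n)) (B : 'M[R]_(n, p)) C :
  fdot (A *m B) C = fdot A (C *m B^T).
Proof. by rewrite !fdot_tr trmx_mul -mulmxA mxtrace_mulC mulmxA. Qed.

Lemma fdot_trmx m n (A B : 'M[R]_(m, n)) : fdot A^T B^T = fdot A B.
Proof.
rewrite /fdot exchange_big; apply: eq_bigr => i _; apply: eq_bigr => j _.
by rewrite !mxE.
Qed.

Lemma fdot_scalar d (a b : R) : fdot (a%:M : 'M[R]_d) b%:M = a * b * d%:R.
Proof. by rewrite fdot_tr tr_scalar_mx -scalar_mxM mxtrace_scalar mulr_natr.
  Qed.

Lemma discriminant_le (p q s : R) : 0 <= s ->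
  (forall t, 0 <= p + 2 * t * q + t ^+ 2 * s) -> q ^+ 2 <= p * s.
Proof.
move=> s0 h; have p0 : 0 <= p by have := h 0;
  rewrite mulr0 mul0r expr0n/= mul0r !addr0.
have [s_gt0|] := ltP 0 s; last first.
  move=> sle0; have s_eq0 : s = 0 by lra.
  have [->|q0] := eqVneq q 0; first by rewrite expr0n/= mulr_ge0.
  (* With s = 0 the polynomial is affine in t, and at this t it equals -1. *)
  have := h (- (p + 1) / (2 * q)); rewrite s_eq0 mulr0 addr0.
  have -> : 2 * (- (p + 1) / (2 * q)) * q = - (p + 1) by field.
  lra.
have := h (- q / s).
have -> : p + 2 * (- q / s) * q + (- q / s) ^+ 2 * s = (p * s - q ^+ 2) / s.
  by field; rewrite gt_eqF.
by rewrite pmulr_lge0 ?invr_gt0// subr_ge0.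
Qed.

Lemma fdot_cauchy m n (A B : 'M[R]_(m, n)) :
  fdot A B ^+ 2 <= fdot A A * fdot B B.
Proof.
apply: discriminant_le (fdot_ge0 _) _ => t.
have := fdot_ge0 (A + t *: B); rewrite !fdotE (fdotC B A).
congr (0 <= _); ring.
Qed.

Lemma fdot_le_frobenius m n (A B : 'M[R]_(m, n)) :
  fdot A B <= frobenius A * frobenius B.
Proof.
have [h|/ltW h] := leP 0 (fdot A B); last first.
  by rewrite (le_trans h)// mulr_ge0// frobenius_ge0.
rewrite -(@ler_pXn2r _ 2) ?nnegrE ?mulr_ge0 ?frobenius_ge0//.
by rewrite exprMn !frobenius_sqr fdot_cauchy.
Qed.

Lemma fdot_col m n (A B : 'M[R]_(m, n)) :
  fdot A B = \sum_j fdot (col j A) (col j B).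
Proof.
rewrite /fdot exchange_big; apply: eq_bigr => j _; apply: eq_bigr => i _.
by rewrite big_ord1 !mxE.
Qed.

Lemma col_mulmx m n p (A : 'M[R]_(m, n)) (B : 'M[R]_(n, p)) j :
  col j (A *m B) = A *m col j B.
Proof. by rewrite !colE mulmxA. Qed.

End InnerProduct.

Section Spectrum.
Context {R : realType} {d : nat}.
Implicit Types A B : 'M[R]_d.

(** Symmetric matrices with spectrum in [a, b], expressed by the Rayleigh quotient. One predicate
    serves S, S' and, with a = 0 and b = L, the Hessian. *)
Definition specset (a b : R) : set 'M[R]_d :=
  [set A | A^T = A /\
    forall x : 'cV[R]_d, a * fdot x x <= fdot x (A *m x) <= b * fdot x x].

Lemma loewner_scalarl a A : loewner_le a%:M A <->
  forall x : 'cV[R]_d, a * fdot x x <= fdot x (A *m x).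
Proof.
by split=> h x; have := h x;
  rewrite dotv_fdot mulmxBl mul_scalar_mx !fdotE subr_ge0.
Qed.

Lemma loewner_scalarr b A : loewner_le A b%:M <->
  forall x : 'cV[R]_d, fdot x (A *m x) <= b * fdot x x.
Proof.
by split=> h x; have := h x;
  rewrite dotv_fdot mulmxBl mul_scalar_mx !fdotE subr_ge0.
Qed.

Lemma loewner_ge0 A : loewner_le 0 A <-> forall x : 'cV[R]_d, 0 <= fdot x (A *m
  x).
Proof. by split=> h x; have := h x; rewrite dotv_fdot subr0. Qed.

Lemma covsetE tau zeta : covset tau zeta = specset zeta^-1 tau^-1.
Proof.
apply/seteqP; split=> A /=.
  move=> [sA /loewner_scalarl h1 /loewner_scalarr h2]; split => // x.
  by rewrite h1 h2.
move=> [sA h]; split => //; first by apply/loewner_scalarl => x;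
  case/andP: (h x).
by apply/loewner_scalarr => x; case/andP: (h x).
Qed.

Lemma specset_sym a b A : specset a b A -> A^T = A. Proof. by case. Qed.

Lemma specset_lb a b A n (X : 'M[R]_(d, n)) : specset a b A ->
  a * fdot X X <= fdot X (A *m X).
Proof.
move=> [_ h]; rewrite !fdot_col mulr_sumr ler_sum// => j _.
by rewrite col_mulmx; case/andP: (h (col j X)).
Qed.

Lemma specset_ub a b A n (X : 'M[R]_(d, n)) : specset a b A ->
  fdot X (A *m X) <= b * fdot X X.
Proof.
move=> [_ h]; rewrite !fdot_col mulr_sumr ler_sum// => j _.
by rewrite col_mulmx; case/andP: (h (col j X)).
Qed.

Lemma psd_mx A n (X : 'M[R]_(d, n)) : (forall x : 'cV_d, 0 <= fdot x (A *m x))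
  ->
  0 <= fdot X (A *m X).
Proof. by move=> h; rewrite fdot_col sumr_ge0// => j _; rewrite col_mulmx. Qed.

(* Polarization: apply the bound on the quadratic form to [x + t A x] and
   [x - t A x]. *)
Lemma symmx_norm (c : R) A n (X : 'M[R]_(d, n)) : 0 <= c -> A^T = A ->
  (forall x : 'cV_d, - (c * fdot x x) <= fdot x (A *m x) <= c * fdot x x) ->
  fdot (A *m X) (A *m X) <= c ^+ 2 * fdot X X.
Proof.
move=> c0 sA hA; rewrite [leLHS]fdot_col [in leRHS]fdot_col mulr_sumr ler_sum//
  => j _.
rewrite col_mulmx; move: (col j X) => x {X j}.
set y := A *m x.
have e : fdot x (A *m y) = fdot y y by rewrite fdotC fdot_mull sA.
have h t : 0 <= c * fdot x x + 2 * t * (- fdot y y) + t ^+ 2 * (c * fdot y y).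
  have /andP[_] := hA (x + t *: y); have /andP[+ _] := hA (x - t *: y).
  rewrite mulmxBr mulmxDr -!scalemxAr -/y !fdotE e (fdotC y x).
  move: (fdot x y) (fdot x x) (fdot y y) (fdot y (A *m y)) => p q r s h1 h2.
  lra.
have := discriminant_le (mulr_ge0 c0 (fdot_ge0 y)) h.
rewrite sqrrN; have := fdot_ge0 y; have := fdot_ge0 x.
move: (fdot x x) (fdot y y) => p r p0 r0 hr.
have [->|rn0] := eqVneq r 0; first by rewrite mulr_ge0 ?sqr_ge0.
have r_gt0 : 0 < r by rewrite lt_neqAle eq_sym rn0.
rewrite -(ler_pM2r r_gt0); apply: le_trans (_ : r ^+ 2 <= _);
  first by rewrite expr2.
by apply: le_trans hr _; rewrite le_eqVlt; apply/orP; left; apply/eqP; ring.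
Qed.

Lemma specset_norm a b A n (X : 'M[R]_(d, n)) : 0 <= a -> 0 <= b ->
  specset a b A -> fdot (A *m X) (A *m X) <= b ^+ 2 * fdot X X.
Proof.
move=> a0 b0 hA; apply: (symmx_norm _ b0 (specset_sym hA)) => x.
rewrite (specset_ub x hA) andbT (le_trans _ (specset_lb x hA))//.
apply: le_trans (mulr_ge0 a0 (fdot_ge0 x)).
rewrite oppr_le0; exact: mulr_ge0 b0 (fdot_ge0 x).
Qed.

(** Both forms lie between 0 and b |x|^2, so the difference has operator norm at most b rather than
    2 b. Applying it to the d columns of the identity gives the Frobenius norm. *)
Lemma specset_dist a b A B : 0 <= a -> a <= b -> specset a b A ->
  specset a b B -> fdot (A - B) (A - B) <= b ^+ 2 * d%:R.
Proof.
move=> a0 ab hA hB; have b0 : 0 <= b by exact: le_trans ab.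
have := @symmx_norm b (A - B) _ 1%:M b0.
rewrite mulmx1 fdot_scalar mulr1 mul1r; apply.
  by rewrite linearB/= (specset_sym hA) (specset_sym hB).
move=> x; rewrite mulmxBl !fdotE.
have := specset_lb x hA; have := specset_lb x hB.
have := specset_ub x hA; have := specset_ub x hB.
have := mulr_ge0 a0 (fdot_ge0 x).
move: (a * _) (b * _) (fdot x (A *m x)) (fdot x (B *m x)) => p q r s.
by move=> *; apply/andP; split; lra.
Qed.

Lemma specset_unit a b A : 0 < a -> specset a b A -> A \in unitmx.
Proof.
move=> a0 hA; rewrite -row_free_unit -kermx_eq0; apply/eqP/row_matrixP => i.
rewrite row0; set v := row i _.
have vA : v *m A = 0 by rewrite -row_mul mulmx_ker row0.
have : A *m v^T = 0 by rewrite -(specset_sym hA) -trmx_mul vA trmx0.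
move=> Av; have := specset_lb v^T hA; rewrite Av.
have -> : fdot v^T 0 = 0 by rewrite /fdot big1// => k _; rewrite big1// => l _;
  rewrite [X in _ * X]mxE mulr0.
rewrite pmulr_rle0// fdot_trmx => h; apply/eqP; rewrite -fdot_eq0 eq_le h.
exact: fdot_ge0.
Qed.

Lemma invmx_sym A : A^T = A -> (invmx A)^T = invmx A.
Proof. by move=> sA; rewrite trmx_inv sA. Qed.

(** With D = S - T one has S^2 - T^2 = S D + D T without any commutation. Pairing with D leaves at
    least m |D|^2, and Cauchy-Schwarz finishes. The lemma yields both the uniqueness of the square
    root and its continuity. *)
Lemma sqrt_lipschitz (m : R) (S T : 'M[R]_d) : 0 <= m ->
  S^T = S -> T^T = T -> (forall x : 'cV_d, m * fdot x x <= fdot x (S *m x)) ->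
  (forall x : 'cV_d, 0 <= fdot x (T *m x)) ->
  m ^+ 2 * fdot (S - T) (S - T) <=
    fdot (S *m S - T *m T) (S *m S - T *m T).
Proof.
move=> m0 sS sT hS hT; set D := S - T; set E := S *m S - T *m T.
have ED : E = S *m D + D *m T.
  by rewrite /E /D mulmxBr mulmxBl addrA subrK.
have h1 : m * fdot D D <= fdot D (S *m D).
  by rewrite !fdot_col mulr_sumr ler_sum// => j _; rewrite col_mulmx.
have h2 : 0 <= fdot D (D *m T).
  by rewrite -fdot_trmx trmx_mul sT psd_mx.
have h3 : m * fdot D D <= fdot D E by rewrite ED [leRHS]fdotDr (le_trans h1)//
  lerDl.
have := fdot_cauchy D E; have := fdot_ge0 D; have := fdot_ge0 E.
move: (fdot D D) (fdot E E) (fdot D E) h3 => p q r h3 q0 p0 hr.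
have [->|pn0] := eqVneq p 0; first by rewrite mulr0.
have pgt0 : 0 < p by rewrite lt_neqAle eq_sym pn0.
rewrite -(ler_pM2l pgt0) (le_trans _ hr)//.
have -> : p * (m ^+ 2 * p) = (m * p) ^+ 2 by ring.
by rewrite ler_pXn2r// nnegrE ?mulr_ge0// (le_trans _ h3)// mulr_ge0.
Qed.

End Spectrum.

(** * Square roots, inverses and projections as continuous maps *)

Section MatrixTopology.
Context {R : realType}.

Lemma continuous_subr (T : topologicalType) (f g : T -> R) :
  continuous f -> continuous g -> continuous (fun x => f x - g x).
Proof. by move=> cf cg x; apply: cvgB; [exact: cf|exact: cg]. Qed.

Lemma continuous_addr (T : topologicalType) (f g : T -> R) :
  continuous f -> continuous g -> continuous (fun x => f x + g x).
Proof. by move=> cf cg x; apply: cvgD; [exact: cf|exact: cg]. Qed.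

Lemma continuous_mulr (T : topologicalType) (f g : T -> R) :
  continuous f -> continuous g -> continuous (fun x => f x * g x).
Proof. by move=> cf cg x; apply: cvgM; [exact: cf|exact: cg]. Qed.

Lemma continuous_sumr (T : topologicalType) (I : Type) (r : seq I)
    (F : I -> T -> R) : (forall i, continuous (F i)) ->
  continuous (fun x => \sum_(i <- r) F i x).
Proof. by move=> cF; apply: continuous_big => //; exact: add_continuous. Qed.

Lemma continuous_mx (T : topologicalType) m n (F : T -> 'M[R]_(m, n)) :
  (forall i j, continuous (fun x => F x i j)) -> continuous F.
Proof.
move=> cF x; apply/cvg_ballP => e e0.
have h i j : \forall y \near x, ball (F x i j) e (F y i j).
  by have /cvg_ballP/(_ e e0) := cF i j x.
have h' : \forall y \near x, forall ij : 'I_m * 'I_n,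
    ball (F x ij.1 ij.2) e (F y ij.1 ij.2).
  by apply: filter_forall => -[i j]; exact: h.
by apply: filterS h' => y hy; split=> // i j; exact: (hy (i, j)).
Qed.

Lemma continuous_mulmx (T : topologicalType) m n p (F : T -> 'M[R]_(m, n))
    (G : T -> 'M[R]_(n, p)) :
  (forall i j, continuous (fun x => F x i j)) ->
  (forall i j, continuous (fun x => G x i j)) ->
  forall i j, continuous (fun x => (F x *m G x) i j).
Proof.
move=> cF cG i j.
have -> : (fun x => (F x *m G x) i j) = fun x => \sum_k F x i k * G x k j.
  by apply/funext => x; rewrite mxE.
by apply: continuous_sumr => k x; apply: continuousM; [exact: cF|exact: cG].
Qed.

Lemma continuous_fdot (T : topologicalType) m n (F G : T -> 'M[R]_(m, n)) :
  (forall i j, continuous (fun x => F x i j)) ->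
  (forall i j, continuous (fun x => G x i j)) ->
  continuous (fun x => fdot (F x) (G x)).
Proof.
move=> cF cG; apply: continuous_sumr => i; apply: continuous_sumr => j x.
by apply: continuousM; [exact: cF|exact: cG].
Qed.

Lemma closed_le_continuous (T : topologicalType) (f g : T -> R) :
  continuous f -> continuous g -> closed [set x | f x <= g x].
Proof.
move=> cf cg.
have -> : [set x | f x <= g x] = (g \- f) @^-1` [set y | 0 <= y].
  by apply/seteqP; split=> x /=; rewrite subr_ge0.
apply: closed_comp; last exact: closed_ge.
by move=> x _; apply: continuousB; [exact: cg|exact: cf].
Qed.

(** The set is the continuous image of a closed subset of a box of row vectors, which is compact as
    a product of segments. *)
Lemma compact_mx m n (K : set 'M[R]_(m, n)) (M : R) : closed K ->
  (forall A, K A -> forall i j, `|A i j| <= M) -> compact K.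
Proof.
move=> cK bK.
have cvec : continuous (@vec_mx R m n).
  apply: continuous_mx => i j.
  have -> : (fun v : 'rV[R]_(m * n) => vec_mx v i j) =
      (fun v : 'rV[R]_(m * n) => v ord0 (mxvec_index i j)).
    by apply/funext => v; rewrite mxE.
  exact: coord_continuous.
have -> : K = (@vec_mx R m n) @` ((@vec_mx R m n) @^-1` K).
  apply/seteqP; split=> [A KA|_ [v Kv <-]//].
  by exists (mxvec A); rewrite /= mxvecK.
apply: continuous_compact; first exact: continuous_subspaceT.
apply: (@subclosed_compact _ _ [set v : 'rV[R]_(m * n) | forall i, v ord0 i \in
  `[- M, M]]).
- by apply: closed_comp => // x _; exact: cvec.
- apply: (@rV_compact _  _ (fun=> `[- M, M]%classic)) => _.
  exact: segment_compact.
- move=> v /= /bK h k; case/mxvec_indexP: k => i j.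
  by have := h i j; rewrite mxE in_itv/= ler_norml.
Qed.

End MatrixTopology.

(** * Existence and uniqueness of the positive square root, and spectral bounds for inverses *)

Section SquareRoot.
Context {R : realType} {d : nat}.
Implicit Types A B Y Z : 'M[R]_d.

(** For r >= 0, the symmetric matrices of operator norm at most r. *)
Definition normle (r : R) : set 'M[R]_d :=
  [set A | A^T = A /\
    forall x : 'cV[R]_d, fdot (A *m x) (A *m x) <= r ^+ 2 * fdot x x].

Lemma normle_mx r A n (X : 'M[R]_(d, n)) : normle r A ->
  fdot (A *m X) (A *m X) <= r ^+ 2 * fdot X X.
Proof.
move=> [_ h]; rewrite [leLHS]fdot_col [in leRHS]fdot_col mulr_sumr ler_sum//.
by move=> j _; rewrite col_mulmx.
Qed.

Lemma fdot_sub_scale m n (D E : 'M[R]_(m, n)) t :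
  fdot (D - t *: E) (D - t *: E) =
    fdot D D - 2 * t * fdot D E + t ^+ 2 * fdot E E.
Proof. rewrite !fdotE (fdotC E D); ring. Qed.

(** Minkowski's inequality in squared form, with a common factor s so that operator norm bounds add
    up. *)
Lemma fdot_add_le m n (U V : 'M[R]_(m, n)) (p q s : R) :
  0 <= p -> 0 <= q -> 0 <= s -> fdot U U <= p ^+ 2 * s ->
  fdot V V <= q ^+ 2 * s -> fdot (U + V) (U + V) <= (p + q) ^+ 2 * s.
Proof.
move=> p0 q0 s0 hU hV; have h : fdot U V <= p * q * s.
  have [u0|/ltW u0] := leP 0 (fdot U V); last first.
    by rewrite (le_trans u0)// !mulr_ge0.
  rewrite -(@ler_pXn2r _ 2) ?nnegrE ?mulr_ge0// (le_trans (fdot_cauchy _ _))//.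
  have -> : (p * q * s) ^+ 2 = (p ^+ 2 * s) * (q ^+ 2 * s) by ring.
  by apply: ler_pM => //; exact: fdot_ge0.
rewrite !fdotE (fdotC V U).
have -> : (p + q) ^+ 2 * s = p ^+ 2 * s + p * q * s + (p * q * s + q ^+ 2 * s).
  by ring.
by rewrite !lerD.
Qed.

Lemma closed_entry_eq (T : topologicalType) (f g : T -> R) :
  continuous f -> continuous g -> closed [set x | f x = g x].
Proof.
move=> cf cg.
have -> : [set x | f x = g x] = [set x | f x <= g x] `&` [set x | g x <= f x].
  apply/seteqP; split=> x /=; first by move=> ->.
  by move=> [h1 h2]; apply/eqP; rewrite eq_le h1 h2.
by apply: closedI; exact: closed_le_continuous.
Qed.

Lemma coord_mx_continuous m n i j : continuous (fun A : 'M[R]_(m, n) => A i j).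
Proof. exact: coord_continuous. Qed.

Lemma cst_entry_continuous (T : topologicalType) m n (B : 'M[R]_(m, n)) i j :
  continuous (fun _ : T => B i j).
Proof. by move=> x; exact: cvg_cst. Qed.

Lemma closed_symmx : closed [set A : 'M[R]_d | A^T = A].
Proof.
have -> : [set A : 'M[R]_d | A^T = A] =
    \bigcap_(ij in [set: 'I_d * 'I_d]) [set A | A ij.2 ij.1 = A ij.1 ij.2].
  apply/seteqP; split=> A /=; [move=> sA|move=> h].
  - by move=> [i j] _ /=; rewrite -[in RHS]sA mxE.
  - by apply/matrixP => i j; rewrite mxE; exact: (h (i, j)).
by apply: closed_bigI => -[i j] _ /=; apply: closed_entry_eq;
  exact: coord_mx_continuous.
Qed.

Lemma compact_normle r : compact (normle r).
Proof.
apply: (@compact_mx _ _ _ _ (Num.sqrt (r ^+ 2 * d%:R))).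
  have -> : normle r = [set A : 'M[R]_d | A^T = A] `&`
      \bigcap_(x in [set: 'cV[R]_d])
      [set A | fdot (A *m x) (A *m x) <= r ^+ 2 * fdot x x].
    apply/seteqP; split=> A /=; first by move=> [sA h]; split=> // x _;
      exact: h.
    by move=> [sA h]; split=> // x; exact: (h x).
  apply: closedI; first exact: closed_symmx.
  apply: closed_bigI => x _; apply: closed_le_continuous.
    by apply: continuous_fdot => i j; apply: continuous_mulmx => {}i {}j;
      [exact: coord_mx_continuous|exact: cst_entry_continuous
      |exact: coord_mx_continuous|exact: cst_entry_continuous].
  by exact: cst_continuous.
move=> A hA i j; rewrite -sqrtr_sqr ler_sqrt; last by apply: mulr_ge0;
  rewrite ?sqr_ge0.
rewrite (le_trans (entry_sqr_le_fdot A i j))//.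
by have := normle_mx 1%:M hA; rewrite mulmx1 fdot_scalar mulr1 mul1r.
Qed.

(** The equation says (I - Y)^2 = I - B. The radius 1 - t is preserved because ((1 - t^2) + (1 -
    t)^2) / 2 = 1 - t. On that ball the map contracts by 1 - t, since F Y - F Z is half of Y (Y - Z)
    + (Y - Z) Z. *)
Lemma sqrt_fixpoint (t : R) B : 0 < t -> t <= 1 -> specset 0 (1 - t ^+ 2) B ->
  exists2 Y, normle (1 - t) Y & Y = 2^-1 *: (B + Y *m Y).
Proof.
move=> t0 t1 hB; set r := 1 - t.
have r0 : 0 <= r by rewrite /r; lra.
have c0 : 0 <= 1 - t ^+ 2 by rewrite subr_ge0 expr_le1// ltW.
pose F (Y : 'M[R]_d) := 2^-1 *: (B + Y *m Y).
have FK Y : normle r Y -> normle r (F Y).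
  move=> hY; have sY := hY.1; split.
    by rewrite /F linearZ/= linearD/= trmx_mul sY (specset_sym hB).
  move=> x; rewrite /F -scalemxAl !fdotE mulmxDl -mulmxA.
  have h1 := specset_norm x (lexx 0) c0 hB.
  have h2 : fdot (Y *m (Y *m x)) (Y *m (Y *m x)) <= (r ^+ 2) ^+ 2 * fdot x x.
    rewrite (le_trans (normle_mx _ hY))// (expr2 (r ^+ 2)) -mulrA.
    by rewrite ler_wpM2l ?sqr_ge0// (normle_mx _ hY).
  have := fdot_add_le c0 (sqr_ge0 r) (fdot_ge0 x) h1 h2.
  have -> : r ^+ 2 * fdot x x =
      2^-1 * (2^-1 * ((1 - t ^+ 2 + r ^+ 2) ^+ 2 * fdot x x)).
    by rewrite /r; field.
  by move=> h; rewrite !ler_wpM2l ?invr_ge0.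
have FL Y Z : normle r Y -> normle r Z ->
    fdot (F Y - F Z) (F Y - F Z) <= r ^+ 2 * fdot (Y - Z) (Y - Z).
  move=> hY hZ.
  have -> : F Y - F Z = 2^-1 *: (Y *m (Y - Z) + (Y - Z) *m Z).
    rewrite /F -scalerBr; congr (_ *: _).
    by rewrite mulmxBr mulmxBl addrA subrK opprD addrACA subrr add0r.
  rewrite fdotZl fdotZr.
  have h1 := normle_mx (Y - Z) hY.
  have h2 : fdot ((Y - Z) *m Z) ((Y - Z) *m Z) <= r ^+ 2 * fdot (Y - Z) (Y - Z).
    by rewrite -fdot_trmx trmx_mul hZ.1 (le_trans (normle_mx _ hZ))// fdot_trmx.
  have := fdot_add_le r0 r0 (fdot_ge0 _) h1 h2.
  have -> : (r + r) ^+ 2 * fdot (Y - Z) (Y - Z) =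
     2 * (2 * (r ^+ 2 * fdot (Y - Z) (Y - Z))) by ring.
  by move=> h; rewrite !ler_pdivrMl.
(* Instead of iterating, minimize the residual |Y - F Y| over the compact ball. Moving from Y to F Y
   multiplies the residual by at most r < 1, so at the minimum it vanishes. *)
have [||Y /set_mem hY minY] := @compact_EVT_min 'M[R]_d R
    (fun Y => fdot (Y - F Y) (Y - F Y)) (normle r) _ (@compact_normle r).
- exists 0; split=> [|x]; first by rewrite trmx0.
  rewrite mul0mx; have /eqP -> : fdot (0 : 'cV[R]_d) 0 == 0 by rewrite fdot_eq0.
  by rewrite mulr_ge0 ?sqr_ge0 ?fdot_ge0.
- apply: continuous_subspaceT.
  have cF i j : continuous (fun Y => (Y - F Y) i j).
    have -> : (fun Y => (Y - F Y) i j) =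
        fun Y : 'M[R]_d => Y i j - 2^-1 * (B i j + (Y *m Y) i j).
      by apply/funext => Y; rewrite /F !mxE.
    apply: continuous_subr; first exact: coord_mx_continuous.
    apply: continuous_mulr; first exact: cst_continuous.
    apply: continuous_addr; first exact: cst_continuous.
    by apply: continuous_mulmx => ? ?; exact: coord_mx_continuous.
  exact: continuous_fdot.
exists Y => //; apply/eqP; rewrite -subr_eq0 -fdot_eq0 -/(F Y).
have := minY (F Y) (mem_set (FK _ hY)).
move/le_trans/(_ (FL _ _ hY (FK _ hY))).
rewrite eq_le fdot_ge0 andbT; move: (fdot _ _) => g h.
have : (1 - r ^+ 2) * g <= 0 by rewrite mulrBl mul1r subr_le0.
rewrite pmulr_rle0// subr_gt0 expr_lt1// /r; lra.
Qed.

(** Apply the fixed point to B = I - A / b, whose form is at most 1 - a / b = 1 - t^2, and rescale I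
    - Y by the root of b. The lower bound for the root is recorded because it is the constant m of
    [sqrt_lipschitz]. *)
Lemma sqrt_exists (a b : R) A : 0 < a -> a <= b -> specset a b A ->
  exists S : 'M[R]_d, [/\ S^T = S,
    forall x : 'cV[R]_d, Num.sqrt a * fdot x x <= fdot x (S *m x) &
    S *m S = A].
Proof.
move=> a0 ab [sA hA]; have b0 : 0 < b by exact: lt_le_trans ab.
set t := Num.sqrt (a / b).
have t2 : t ^+ 2 = a / b by rewrite sqr_sqrtr// divr_ge0// ltW.
have t0 : 0 < t by rewrite sqrtr_gt0 divr_gt0.
have t1 : t <= 1.
  by rewrite -(@ler_pXn2r _ 2) ?nnegrE ?(ltW t0)// t2 expr1n ler_pdivrMr//
    mul1r.
have [|Y hY Yfix] := @sqrt_fixpoint t (1%:M - b^-1 *: A) t0 t1.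
  split=> [|x]; first by rewrite linearB/= linearZ/= sA trmx1.
  rewrite mulmxBl mul1mx -scalemxAl !fdotE mul0r t2.
  have /andP[h1 h2] := hA x; apply/andP; split.
    by rewrite subr_ge0 ler_pdivrMl.
  rewrite mulrBl mul1r lerD2l lerN2 ler_pdivlMl// mulrA (mulrC b).
  by rewrite divfK ?gt_eqF.
have sb : Num.sqrt b * Num.sqrt b = b by rewrite -expr2 sqr_sqrtr// ltW.
exists (Num.sqrt b *: (1%:M - Y)); split.
- by rewrite linearZ/= linearB/= trmx1 hY.1.
- move=> x; rewrite -scalemxAl mulmxBl mul1mx !fdotE.
  have -> : Num.sqrt a = Num.sqrt b * t.
    rewrite /t -sqrtrM ?ltW//; congr Num.sqrt; field; exact/lt0r_neq0.
  rewrite -mulrA ler_wpM2l ?sqrtr_ge0//.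
  have : fdot x (Y *m x) <= (1 - t) * fdot x x.
    have [h|/ltW h] := leP 0 (fdot x (Y *m x)); last first.
      by rewrite (le_trans h)// mulr_ge0 ?fdot_ge0 ?subr_ge0.
    rewrite -(@ler_pXn2r _ 2) ?nnegrE ?mulr_ge0 ?fdot_ge0 ?subr_ge0//.
    rewrite (le_trans (fdot_cauchy _ _))// exprMn (expr2 (fdot x x)) mulrCA.
    by rewrite ler_wpM2l ?fdot_ge0 ?hY.2.
  by rewrite mulrBl mul1r lerBrDl -lerBrDr.
rewrite -scalemxAl -scalemxAr scalerA sb mulmxBr mulmx1 mulmxBl mul1mx.
have -> : Y *m Y = 2 *: Y - (1%:M - b^-1 *: A).
  by rewrite {3}Yfix scalerA divff ?pnatr_eq0// scale1r addrAC subrr add0r.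
rewrite scaler_nat mulr2n !opprB [X in b *: X](_ : _ = b^-1 *: A).
  by rewrite scalerA divff ?gt_eqF// scale1r.
by apply/matrixP => i j; rewrite !mxE; ring.
Qed.

(** The chosen root is compared with the constructed one by [sqrt_lipschitz]: equal squares force
    equality, so the choice inherits the lower bound. *)
Lemma sqrtmxP (a b : R) A : 0 < a -> a <= b -> specset a b A ->
  [/\ (sqrtmx A)^T = sqrtmx A,
   forall x : 'cV[R]_d, Num.sqrt a * fdot x x <= fdot x (sqrtmx A *m x) &
   sqrtmx A *m sqrtmx A = A].
Proof.
move=> a0 ab hA; have [S [sS lS SS]] := sqrt_exists a0 ab hA.
have [|sT /loewner_ge0 pT TT] := @xgetPex _ (0 : 'M[R]_d)
    [set B : 'M[R]_d | [/\ B^T = B, loewner_le 0 B & B *m B = A]].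
  exists S; split=> //; apply/loewner_ge0 => x.
  by rewrite (le_trans _ (lS x))// mulr_ge0 ?sqrtr_ge0 ?fdot_ge0.
rewrite -/(sqrtmx A) in sT pT TT *.
suff -> : sqrtmx A = S by [].
have := sqrt_lipschitz (sqrtr_ge0 a) sS sT lS pT.
have /eqP -> : fdot (S *m S - sqrtmx A *m sqrtmx A)
   (S *m S - sqrtmx A *m sqrtmx A) == 0 by rewrite fdot_eq0 SS TT subrr.
rewrite (sqr_sqrtr (ltW a0)) pmulr_rle0// => h.
apply/esym/eqP; rewrite -subr_eq0 -fdot_eq0 eq_le h; exact: fdot_ge0.
Qed.

(** Put x = A y and A = S S. Then the form of the inverse at x is |S y|^2, while |x|^2 is the form
    of A at S y, so the bounds for A turn into reciprocal bounds. *)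
Lemma specset_inv (a b : R) A : 0 < a -> a <= b -> specset a b A ->
  specset b^-1 a^-1 (invmx A).
Proof.
move=> a0 ab hA; have b0 : 0 < b by exact: lt_le_trans ab.
have uA := specset_unit a0 hA.
have [sS lS SS] := sqrtmxP a0 ab hA; set S := sqrtmx A in sS lS SS.
split=> [|x]; first by rewrite invmx_sym// (specset_sym hA).
set y := invmx A *m x; have -> : x = A *m y by rewrite /y mulKVmx.
have e1 : fdot (A *m y) y = fdot (S *m y) (S *m y).
  by rewrite -SS -mulmxA fdot_mull sS.
have e2 : fdot (A *m y) (A *m y) = fdot (S *m y) (A *m (S *m y)).
  by rewrite -SS -!mulmxA fdot_mull sS.
rewrite e1 e2 ler_pdivrMl// ler_pdivlMl//.
by rewrite (specset_ub _ hA) (specset_lb _ hA).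
Qed.

(** In this form S' is visibly closed and convex, which its definition as a set of inverses
    hides. *)
Lemma precsetE (tau zeta : R) : 0 < tau -> tau <= zeta ->
  precset tau zeta = specset tau zeta :> set 'M[R]_d.
Proof.
move=> t0 tz; have z0 : 0 < zeta by exact: lt_le_trans tz.
rewrite /precset covsetE; apply/seteqP; split=> [_ [A hA <-]|A hA] /=.
  rewrite -(invrK tau) -(invrK zeta); apply: specset_inv => //.
    by rewrite invr_gt0.
  by rewrite lef_pV2.
by exists (invmx A); [exact: specset_inv|rewrite invmxK].
Qed.

End SquareRoot.

(** * The metric projection onto S' *)

Section Projection.
Context {R : realType} {d : nat}.
Variables (tau zeta : R).
Hypotheses (tau_gt0 : 0 < tau) (tau_le_zeta : tau <= zeta).
Implicit Types A B X Y : 'M[R]_d.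

Let zeta_ge0 : 0 <= zeta. Proof. by rewrite (le_trans _ tau_le_zeta)// ltW. Qed.

Lemma compact_specset : compact (specset tau zeta : set 'M[R]_d).
Proof.
apply: subclosed_compact (@compact_normle R d zeta) _.
  have -> : specset tau zeta = [set A : 'M[R]_d | A^T = A] `&`
      (\bigcap_(x in [set: 'cV[R]_d])
        [set A | tau * fdot x x <= fdot x (A *m x)] `&`
       \bigcap_(x in [set: 'cV[R]_d])
        [set A | fdot x (A *m x) <= zeta * fdot x x]).
    apply/seteqP; split=> A /=.
      by move=> [sA h]; split=> //; split=> x _; have /andP[] := h x.
    by move=> [sA [h1 h2]]; split=> // x; rewrite (h1 x I) (h2 x I).
  have cA (x : 'cV[R]_d) : continuous (fun A : 'M[R]_d => fdot x (A *m x)).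
    by apply: continuous_fdot => [|i j]; [exact: cst_entry_continuous|];
      apply: continuous_mulmx => {}i {}j;
      [exact: coord_mx_continuous|exact: cst_entry_continuous].
  apply: closedI; first exact: closed_symmx.
  by apply: closedI; apply: closed_bigI => x _;
    apply: closed_le_continuous => //;
    exact: cst_continuous.
move=> A hA; split=> [|x]; first exact: specset_sym hA.
by apply: specset_norm hA => //; exact: ltW.
Qed.

Lemma specset_scalar (c : R) : tau <= c <= zeta ->
  specset tau zeta (c%:M : 'M[R]_d).
Proof.
move=> /andP[h1 h2]; split=> [|x]; first by rewrite tr_scalar_mx.
by rewrite mul_scalar_mx fdotE !ler_wpM2r ?fdot_ge0.
Qed.

Lemma specset_convex t X Y : 0 <= t <= 1 -> specset tau zeta X ->
  specset tau zeta Y -> specset tau zeta (X + t *: (Y - X)).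
Proof.
move=> /andP[t0 t1] hX hY; split=> [|x].
  by rewrite linearD/= linearZ/= linearB/= (specset_sym hX) (specset_sym hY).
rewrite mulmxDl -scalemxAl mulmxBl !fdotE.
have := specset_lb x hX; have := specset_lb x hY.
have := specset_ub x hX; have := specset_ub x hY.
move: (fdot x x) (fdot x (X *m x)) (fdot x (Y *m x)) => s p q h1 h2 h3 h4.
by apply/andP; split; nra.
Qed.

Lemma proj_precP A : specset tau zeta (proj_prec tau zeta A) /\
  forall Y, specset tau zeta Y ->
    fdot (A - proj_prec tau zeta A) (A - proj_prec tau zeta A) <=
    fdot (A - Y) (A - Y).
Proof.
have [] := @xgetPex _ (0 : 'M[R]_d) [set X : 'M[R]_d | precset tau zeta X /\
    forall Y, precset tau zeta Y -> frobenius (A - X) <= frobenius (A - Y)].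
  have [||X /set_mem hX minX] := @compact_EVT_min 'M[R]_d R
    (fun Y => fdot (A - Y) (A - Y)) (specset tau zeta) _ compact_specset.
  - by exists tau%:M; apply: specset_scalar; rewrite lexx.
  - apply: continuous_subspaceT.
    have cF i j : continuous (fun Y => (A - Y) i j).
      have -> : (fun Y => (A - Y) i j) = fun Y : 'M[R]_d => A i j - Y i j.
        by apply/funext => Y; rewrite !mxE.
      apply: continuous_subr; first exact: cst_continuous.
      exact: coord_mx_continuous.
    exact: continuous_fdot.
  exists X; rewrite /= precsetE//; split=> // Y hY.
  rewrite -(@ler_pXn2r _ 2) ?nnegrE ?frobenius_ge0// !frobenius_sqr.
  by apply: minX; rewrite inE.
rewrite -/(proj_prec tau zeta A) precsetE// => h1 h2; split=> // Y /h2.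
by rewrite -(@ler_pXn2r _ 2) ?nnegrE ?frobenius_ge0// !frobenius_sqr.
Qed.

Lemma proj_prec_in A : specset tau zeta (proj_prec tau zeta A).
Proof. by have [] := proj_precP A. Qed.

Lemma proj_prec_obtuse A Y : specset tau zeta Y ->
  fdot (A - proj_prec tau zeta A) (Y - proj_prec tau zeta A) <= 0.
Proof.
move=> hY; have [hP minP] := proj_precP A;
  set P := proj_prec tau zeta A in hP minP *.
rewrite leNgt; apply/negP => c0; set c := fdot _ _ in c0.
have q0 := fdot_ge0 (Y - P); set q := fdot (Y - P) (Y - P) in q0.
have key t : 0 <= t <= 1 -> 0 <= t * (t * q - 2 * c).
  move=> ht; have := minP _ (specset_convex ht hP hY).
  rewrite opprD addrA fdot_sub_scale -/c -/q -addrA lerDl.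
  by congr (0 <= _); ring.
(* For c > 0, moving from P towards Y would bring the point closer to A; the quadratic in t is
   minimal at c / q. If that exceeds or equals 1, then t = 1 is contradictory already. *)
have [qc|cq] := leP q c.
  have := key 1; rewrite ler01 lexx => /(_ isT); lra.
have q_gt0 : 0 < q by exact: lt_trans cq.
have := key (c / q); rewrite divr_ge0 ?(ltW c0) ?(ltW q_gt0)//=.
rewrite ler_pdivrMr// mul1r (ltW cq) => /(_ isT).
rewrite divfK ?gt_eqF// pmulr_rge0 ?divr_gt0//; lra.
Qed.

Lemma proj_prec_closer A Y : specset tau zeta Y ->
  fdot (proj_prec tau zeta A - Y) (proj_prec tau zeta A - Y) <=
  fdot (A - Y) (A - Y).
Proof.
move=> hY; have := proj_prec_obtuse A hY; set P := proj_prec tau zeta A.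
have -> : A - Y = (A - P) - 1 *: (Y - P).
  by rewrite scale1r opprB addrA subrK.
rewrite fdot_sub_scale.
have -> : fdot (P - Y) (P - Y) = fdot (Y - P) (Y - P).
  by rewrite -[P - Y]opprB fdotNl fdotNr opprK.
have := fdot_ge0 (A - P); move: (fdot _ _) (fdot _ _) (fdot _ _) => p q r.
lra.
Qed.

(** Adding the obtuse angle inequalities at the two projections gives |p - q|^2 <= <A - B, p - q>;
    Cauchy-Schwarz does the rest. *)
Lemma proj_prec_lipschitz A B :
  fdot (proj_prec tau zeta A - proj_prec tau zeta B)
       (proj_prec tau zeta A - proj_prec tau zeta B) <= fdot (A - B) (A - B).
Proof.
have hA := proj_prec_obtuse A (proj_prec_in B).
have hB := proj_prec_obtuse B (proj_prec_in A).
move: (proj_prec tau zeta A) (proj_prec tau zeta B) hA hB => p q hA hB.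
have h : fdot (p - q) (p - q) <= fdot (A - B) (p - q).
  rewrite -subr_ge0 -[leRHS]opprK oppr_ge0.
  apply: le_trans (_ : fdot (A - p) (q - p) + fdot (B - q) (p - q) <= 0);
    last first.
    by rewrite -(addr0 0) lerD.
  rewrite le_eqVlt; apply/orP; left; apply/eqP; rewrite !fdotE; ring.
have := fdot_cauchy (A - B) (p - q).
have := fdot_ge0 (A - B); have := fdot_ge0 (p - q).
move: h; set s := fdot (p - q) (p - q); set t := fdot (A - B) (A - B).
move=> h s0 t0 hu; have [->//|sn0] := eqVneq s 0.
have s_gt0 : 0 < s by rewrite lt_neqAle eq_sym sn0.
rewrite -(ler_pM2r s_gt0) (le_trans _ hu)// -expr2 ler_pXn2r// nnegrE ltW//.
exact: lt_le_trans h.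
Qed.

End Projection.

Section MatrixFunctions.
Context {R : realType} {d : nat}.

(** A squared modulus of continuity that vanishes on the diagonal suffices, so Lipschitz bounds on
    [fdot] apply without taking roots. *)
Lemma continuous_sqr_modulus (T : topologicalType) (f : T -> R)
    (G : T -> T -> R) :
  (forall x, continuous (G x)) -> (forall x, G x x = 0) ->
  (forall x y, (f x - f y) ^+ 2 <= G x y) -> continuous f.
Proof.
move=> cG G0 hf x; apply/cvgrPdist_lt => e e0.
have Gx : G x x < e ^+ 2 by rewrite G0 exprn_gt0.
have near_small : \forall y \near x, G x y < e ^+ 2.
  exact: (cvgr_lt (G x x) (cG x x)).
apply: filterS near_small => y hy; rewrite -(@ltr_pXn2r _ 2) ?nnegrE ?(ltW
  e0)//.
by rewrite real_normK ?num_real// (le_lt_trans (hf x y)).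
Qed.

Lemma lipschitz_entry_continuous m n p q (F : 'M[R]_(m, n) -> 'M[R]_(p, q)) c :
  (forall A B, fdot (F A - F B) (F A - F B) <= c * fdot (A - B) (A - B)) ->
  forall i j, continuous (fun A => F A i j).
Proof.
move=> hF i j.
apply: (@continuous_sqr_modulus 'M[R]_(m, n) (fun A => F A i j)
  (fun A B : 'M[R]_(m, n) => c * fdot (A - B) (A - B))).
- move=> A; apply: continuous_mulr; first exact: cst_continuous.
  have cE k l : continuous (fun B : 'M[R]_(m, n) => (A - B) k l).
    have -> : (fun B => (A - B) k l) = fun B : 'M[R]_(m, n) => A k l - B k l.
      by apply/funext => B; rewrite !mxE.
    apply: continuous_subr; first exact: cst_continuous.
    exact: coord_mx_continuous.
  exact: continuous_fdot.
- move=> A; have /eqP -> : fdot (A - A) (A - A) == 0 by rewrite fdot_eq0 subrr.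
  by rewrite mulr0.
- move=> A B; apply: le_trans (hF A B).
  by have := entry_sqr_le_fdot (F A - F B) i j; rewrite !mxE.
Qed.

(** Resolvent identity: the difference of the inverses is - A^-1 (A - B) B^-1, and each outer factor
    has norm at most 1 / a. *)
Lemma invmx_lipschitz (a b : R) (A B : 'M[R]_d) : 0 < a -> a <= b ->
  specset a b A -> specset a b B ->
  fdot (invmx A - invmx B) (invmx A - invmx B) <=
    (a^-1 ^+ 2) ^+ 2 * fdot (A - B) (A - B).
Proof.
move=> a0 ab hA hB.
have a'0 : 0 <= a^-1 by rewrite invr_ge0 ltW.
have b'0 : 0 <= b^-1 by rewrite invr_ge0 ltW// (lt_le_trans a0).
have iA := specset_inv a0 ab hA; have iB := specset_inv a0 ab hB.
have -> : invmx A - invmx B = - (invmx A *m ((A - B) *m invmx B)).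
  rewrite mulmxBl mulmxV ?(specset_unit a0 hB)// mulmxBr mulmx1 mulmxA.
  by rewrite mulVmx ?(specset_unit a0 hA)// mul1mx opprB.
rewrite fdotNl fdotNr opprK (le_trans (specset_norm _ b'0 a'0 iA))//.
rewrite (expr2 (a^-1 ^+ 2)) -mulrA ler_wpM2l ?sqr_ge0//.
rewrite -fdot_trmx trmx_mul (specset_sym iB) (le_trans (specset_norm _ b'0 a'0
  iB))//.
by rewrite fdot_trmx.
Qed.

Variables (tau zeta : R).
Hypotheses (tau_gt0 : 0 < tau) (tau_le_zeta : tau <= zeta).

(* Precomposing with the projection makes the inverse and its square root
   globally Lipschitz, hence measurable functions of the entries. *)
Lemma sqrtmx_invmx_proj_continuous i j :
  continuous (fun A : 'M[R]_d => sqrtmx (invmx (proj_prec tau zeta A)) i j).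
Proof.
have z0 : 0 < zeta by exact: lt_le_trans tau_le_zeta.
(* In squared norms the projection contributes 1, the inverse tau^-4, and the root zeta, because its
   lower bound is the square root of 1 / zeta. *)
pose c := zeta * (tau^-1 ^+ 2) ^+ 2.
apply: (@lipschitz_entry_continuous _ _ _ _
  (fun A => sqrtmx (invmx (proj_prec tau zeta A))) c) => A B.
have pA := proj_prec_in tau_gt0 tau_le_zeta A.
have pB := proj_prec_in tau_gt0 tau_le_zeta B.
have lz : 0 < zeta^-1 by rewrite invr_gt0.
have lzt : zeta^-1 <= tau^-1 by rewrite lef_pV2.
have [sS lS SS] := sqrtmxP lz lzt (specset_inv tau_gt0 tau_le_zeta pA).
have [sT lT TT] := sqrtmxP lz lzt (specset_inv tau_gt0 tau_le_zeta pB).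
have pT (x : 'cV[R]_d) :
    0 <= fdot x (sqrtmx (invmx (proj_prec tau zeta B)) *m x).
  by rewrite (le_trans _ (lT x))// mulr_ge0 ?sqrtr_ge0 ?fdot_ge0.
have := sqrt_lipschitz (sqrtr_ge0 _) sS sT lS pT.
rewrite SS TT sqr_sqrtr ?(ltW lz)// ler_pdivrMl// => /le_trans; apply.
rewrite /c -mulrA ler_wpM2l ?(ltW z0)//.
rewrite (le_trans (invmx_lipschitz tau_gt0 tau_le_zeta pA pB))//.
by rewrite ler_wpM2l ?sqr_ge0 ?proj_prec_lipschitz.
Qed.

Lemma proj_prec_continuous i j :
  continuous (fun A : 'M[R]_d => proj_prec tau zeta A i j).
Proof.
apply: (@lipschitz_entry_continuous _ _ _ _ (proj_prec tau zeta) 1) => A B.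
by rewrite mul1r proj_prec_lipschitz.
Qed.

End MatrixFunctions.

(** * Measurability and independence *)

Section MatrixMeasurability.
Context {R : realType}.

(** An open set is a countable union of rational cubes, and the preimage of a cube is a finite
    intersection of coordinate events. The source space is arbitrary, so the result also applies to
    the sigma-algebra of the past. *)
Lemma measurable_preimage_open_mx d (S : measurableType d) m n
    (X : S -> 'M[R]_(m, n)) (U : set 'M[R]_(m, n)) :
  (forall i j, measurable_fun setT (fun w => X w i j)) -> open U ->
  measurable (X @^-1` U).
Proof.
move=> mX oU.
pose box (qk : 'M[rat]_(m, n) * nat) := [set A : 'M[R]_(m, n) |
  forall i j, `|A i j - ratr (qk.1 i j)| < qk.2.+1%:R^-1].
pose D := [set qk | box qk `<=` U].
have -> : X @^-1` U =
    \bigcup_qk (if `[< D qk >] then X @^-1` box qk else set0).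
  apply/seteqP; split => [w /= Uw|w [qk _]]; last first.
    by case: ifPn => // /asboolP; apply.
  have /nbhs_ballP[e /= e0 he] := oU _ Uw.
  (* Half the radius: the cube must contain X w and, wherever its rational centre falls within 1 /
     (k + 1) of X w, stay inside the ball. *)
  have [k hk] := ltr_add_invr (divr_gt0 e0 (ltr0n R 2)).
  rewrite add0r in hk.
  have /choice[q hq] : forall ij : 'I_m * 'I_n, exists q : rat,
      `|X w ij.1 ij.2 - ratr q| < k.+1%:R^-1.
    move=> ij; have xy : X w ij.1 ij.2 - k.+1%:R^-1 < X w ij.1 ij.2 +
      k.+1%:R^-1.
      by rewrite ltrD2l gtrN ?invr_gt0.
    have [q] := rat_in_itvoo xy; rewrite in_itv/= => /andP[h1 h2].
    by exists q; rewrite ltr_norml ltrBrDr addrC -ltrBrDr opprK h2 ltrBlDr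
      -ltrBlDl h1.
  exists (\matrix_(i, j) q (i, j), k) => //; rewrite ifT.
    by move=> i j /=; rewrite mxE; exact: (hq (i, j)).
  apply/asboolP => A hA; apply: he; split=> // i j.
  rewrite /ball/= (le_lt_trans (ler_distD (ratr (q (i, j))) _ _))//.
  have := hq (i, j); have /= := hA i j; rewrite mxE distrC => h1 h2.
  rewrite (splitr e); apply: ltrD; first exact: lt_trans h2 hk.
  by rewrite distrC; exact: lt_trans h1 hk.
apply: countable_bigcupT_measurable => // qk; case: ifPn => // _.
have -> : X @^-1` box qk = \bigcap_(ij in [set: 'I_m * 'I_n])
    (fun w => X w ij.1 ij.2) @^-1`
      [set x | `|x - ratr (qk.1 ij.1 ij.2)| < qk.2.+1%:R^-1].
  apply/seteqP; split => w /= h; first by move=> [i j] _; exact: h.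
  by move=> i j; exact: (h (i, j)).
apply: fin_bigcap_measurable; first exact: finite_finset.
move=> [i j] _; rewrite -[X in measurable X]setTI; apply: mX => //=.
have -> : [set x : R | `|x - ratr (qk.1 i j)| < qk.2.+1%:R^-1] =
    `]ratr (qk.1 i j) - qk.2.+1%:R^-1, ratr (qk.1 i j) + qk.2.+1%:R^-1[%classic.
  by apply/seteqP; split=> x /=; rewrite in_itv/= ltr_distl.
exact: measurable_itv.
Qed.

Lemma continuous_measurable_mx d (S : measurableType d) m n
    (X : S -> 'M[R]_(m, n)) (f : 'M[R]_(m, n) -> R) :
  (forall i j, measurable_fun setT (fun w => X w i j)) -> continuous f ->
  measurable_fun setT (fun w => f (X w)).
Proof.
move=> mX /continuousP cf; apply: (measurability _ (RGenOpens.measurableE R)) =>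
  //.
move=> _ [_ [a [b ->] <-]]; rewrite setTI.
apply: (measurable_preimage_open_mx mX (U := f @^-1` `]a, b[%classic)).
exact/cf/interval_open.
Qed.

End MatrixMeasurability.

(** * Expectation of a product of two independent integrable variables *)

Section IndependentProduct.
Context {R : realType} {d : measure_display} {S : measurableType d}.
Variable P : probability S R.

Definition indep_rv (X Y : S -> R) := forall A B, measurable A -> measurable B
  ->
  P (X @^-1` A `&` Y @^-1` B) = (P (X @^-1` A) * P (Y @^-1` B))%E.

Variables X Y : S -> R.
Hypotheses (mX : measurable_fun setT X) (mY : measurable_fun setT Y).
Hypothesis XY_indep : indep_rv X Y.

#[local] HB.instance Definition _ := isMeasurableFun.Build _ _ _ _ X mX.
#[local] HB.instance Definition _ := isMeasurableFun.Build _ _ _ _ Y mY.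

Let Z (w : S) := (X w, Y w).
Let mZ : measurable_fun setT Z. Proof. exact: measurable_fun_pair. Qed.
#[local] HB.instance Definition _ := isMeasurableFun.Build _ _ _ _ Z mZ.

Let PX := distribution P X.
Let PY := distribution P Y.
Let PZ := distribution P Z.

(** Independence says that the joint law and the product of the marginals agree on rectangles, which
    determines the measure. Fubini's theorem then applies to (x, y) -> x y. *)
Let PZE A : measurable A -> PZ A = (PX \x PY)%E A.
Proof.
by move=> mA; apply/esym/product_measure_unique.
Qed.

Hypothesis iX : P.-integrable setT (EFin \o X).
Hypothesis iY : P.-integrable setT (EFin \o Y).

Let f (z : R * R) : \bar R := (z.1 * z.2)%:E.

Let mf : measurable_fun setT f.
Proof.
apply/measurable_EFinP; apply: measurable_funM;
  [exact: measurable_fst|exact: measurable_snd].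
Qed.

Let absX : (\int[PX]_x `|x%:E| = \int[P]_w `|(X w)%:E|)%E.
Proof.
rewrite (@ge0_integral_distribution _ _ _ _ _ P X (fun x => `|x%:E|%E))//.
by do 2 apply: measurableT_comp => //.
Qed.

Let absY : (\int[PY]_x `|x%:E| = \int[P]_w `|(Y w)%:E|)%E.
Proof.
rewrite (@ge0_integral_distribution _ _ _ _ _ P Y (fun x => `|x%:E|%E))//.
by do 2 apply: measurableT_comp => //.
Qed.

Let f_integrable : (PX \x PY)%E.-integrable setT f.
Proof.
apply/integrable12ltyP => //.
have [_ hX] := integrableP _ _ _ iX; have [_ hY] := integrableP _ _ _ iY.
have finX : (\int[P]_w `|(X w)%:E|)%E \is a fin_num.
  by rewrite ge0_fin_numE// integral_ge0.
have finY : (\int[P]_w `|(Y w)%:E|)%E \is a fin_num.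
  by rewrite ge0_fin_numE// integral_ge0.
have inner x : (\int[PY]_y `|f (x, y)| = `|x%:E| * \int[P]_w `|(Y w)%:E|)%E.
  under eq_integral do rewrite /f/= normrM EFinM.
  by rewrite ge0_integralZl//=; [rewrite absY|exact: measurableT_comp].
under eq_integral do rewrite inner.
rewrite ge0_integralZr//=; last 2 first.
- by do 2 apply: measurableT_comp => //.
- exact: integral_ge0.
by rewrite absX -(fineK finX) -(fineK finY) -EFinM ltry.
Qed.

Lemma indep_integrable : P.-integrable setT (EFin \o (fun w => X w * Y w)).
Proof.
apply/integrableP; split; first by apply/measurable_EFinP/measurable_funM.
have [_] := integrableP _ _ _ f_integrable.
rewrite (eq_measure_integral PZ)//; last by move=> A mA _; exact/esym/PZE.
by rewrite (@ge0_integral_distribution _ _ _ _ _ P Z (fun x => `|f x|%E))//;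
  exact: measurableT_comp.
Qed.

Lemma indep_Rintegral :
  \int[P]_w (X w * Y w) = (\int[P]_w X w) * (\int[P]_w Y w).
Proof.
have finX := integrable_fin_num measurableT iX.
have finY := integrable_fin_num measurableT iY.
rewrite /Rintegral -fineM//; congr fine.
rewrite -(integral_distribution (X := Z) (f := f) mf indep_integrable).
rewrite (eq_measure_integral (PX \x PY)%E); last by move=> A mA _; exact/PZE.
rewrite -integral12_prod_meas1//.
have iPY : PY.-integrable setT EFin.
  by apply/integrableP; split=> //; rewrite absY;
    have [_] := integrableP _ _ _ iY.
have iPX : PX.-integrable setT EFin.
  by apply/integrableP; split=> //; rewrite absX;
    have [_] := integrableP _ _ _ iX.
have eY : (\int[PY]_y y%:E = \int[P]_w (Y w)%:E)%E by rewrite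
  integral_distribution.
have eX : (\int[PX]_y y%:E = \int[P]_w (X w)%:E)%E by rewrite
  integral_distribution.
have inner x : fubini_F PY f x = (x%:E * \int[P]_w (Y w)%:E)%E.
  rewrite -eY -integralZl//; exact: eq_integral.
transitivity (\int[PX]_x (x%:E * (fine (\int[P]_w (Y w)%:E))%:E))%E.
  by apply: eq_integral => x _; rewrite fineK// -inner.
by rewrite integralZr//= eX fineK.
Qed.

End IndependentProduct.

(** * Moments of the normal law *)

Section NormalMoments.
Context {R : realType}.
Notation mu := (@lebesgue_measure R).
Notation N := (@normal_prob R 0 1).

Let pdfE x : normal_pdf 0 1 x = normal_peak 1 * expR (- x ^+ 2 / 2) :> R.
Proof.
by rewrite normal_pdfE ?oner_neq0//= /normal_fun subr0 expr1n.
Qed.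

(** The Radon-Nikodym derivative and the explicit density have the same integral over every
    measurable set, hence agree almost everywhere. *)
Lemma ge0_integral_normal_prob (f : R -> \bar R) :
  (forall x, 0 <= f x)%E -> measurable_fun setT f ->
  (\int[N]_x f x = \int[mu]_x (f x * (normal_pdf 0 1 x)%:E))%E.
Proof.
move=> f0 mf.
have Nmu := normal_prob_dominates 0 (1 : R).
rewrite -(Radon_Nikodym_SigmaFinite.change_of_variables Nmu)//.
have mpdf : measurable_fun setT (EFin \o (@normal_pdf R 0 1)).
  by apply/measurable_EFinP; exact: measurable_normal_pdf.
have iRN := Radon_Nikodym_SigmaFinite.f_integrable Nmu.
apply: ae_eq_integral => //.
- exact: emeasurable_funM mf (measurable_int _ iRN).
- exact: emeasurable_funM.
- apply: ae_eqe_mul2l; apply: integral_ae_eq => //.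
  by move=> E _ mE; rewrite -Radon_Nikodym_SigmaFinite.f_integral.
Qed.

Lemma integral_normal_prob (f : R -> \bar R) : measurable_fun setT f ->
  (\int[N]_x f x = \int[mu]_x (f x * (normal_pdf 0 1 x)%:E))%E.
Proof.
move=> mf; rewrite [LHS]integralE [RHS]integralE.
rewrite !ge0_integral_normal_prob//; last 2 first.
- exact: measurable_funeneg.
- exact: measurable_funepos.
have p0 x : (0 <= (@normal_pdf R 0 1 x)%:E)%E by rewrite lee_fin normal_pdf_ge0.
congr (_ - _)%E; apply: eq_integral => x _.
  by rewrite !funeposE maxe_pMl// mul0e.
by rewrite !funenegE maxe_pMl// mul0e mulNe.
Qed.

Lemma exprn_le_expR (y : R) n : 0 <= y ->
  y ^+ n <= (4 * n.+1%:R) ^+ n * expR (y / 4).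
Proof.
(* From z <= exp z at z = y / c. This c makes n y / c at most y / 4, and n + 1 keeps it nonzero when
   n = 0. *)
move=> y0; set c : R := 4 * n.+1%:R.
have c0 : 0 < c by rewrite mulr_gt0.
have e : (y / c) ^+ n <= expR (y / 4).
  apply: (@le_trans _ _ (expR (y / c) ^+ n)).
    rewrite lerXn2r ?nnegrE ?divr_ge0 ?expR_ge0 ?(ltW c0)//.
    by rewrite (le_trans _ (expR_ge1Dx _))// lerDr.
  rewrite -expRM_natl ler_expR.
  have -> : n%:R * (y / c) = y / 4 * (n%:R / n.+1%:R).
    by rewrite /c invfM mulrCA !mulrA (mulrAC y) (mulrAC _ n%:R) -mulrA.
  by rewrite ler_piMr ?divr_ge0// ler_pdivrMr// mul1r ler_nat.
rewrite -(@ler_pM2l _ (c ^- n)) ?invr_gt0 ?exprn_gt0//.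
by rewrite mulKf ?expf_neq0 ?gt_eqF// (le_trans _ e)// expr_div_n mulrC.
Qed.

Let g (x : R) : R := expR (- x ^+ 2 / 2).

(** Half of the Gaussian exponent absorbs the power: |x^n| <= 1 + x^(2 n), and both terms are
    bounded by a multiple of exp (x^2 / 4). *)
Lemma exprn_gauss_bound n : exists2 C : R, 0 <= C &
  forall x : R, `|x ^+ n * g x| <= C * expR (- x ^+ 2 / 4).
Proof.
exists (1 + (4 * n.+1%:R) ^+ n); first by rewrite addr_ge0// exprn_ge0//
  mulr_ge0.
move=> x; rewrite normrM [`|g x|]ger0_norm ?expR_ge0//.
have -> : g x = expR (- x ^+ 2 / 4) / expR (x ^+ 2 / 4).
  by rewrite -expRN -expRD; congr expR; field.
rewrite mulrCA mulrC ler_wpM2r ?expR_ge0// ler_pdivrMr ?expR_gt0//.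
have h1 : `|x ^+ n| <= 1 + (x ^+ 2) ^+ n.
  rewrite -exprM mulnC exprM -[X in _ + X]real_normK ?num_real//.
  have := normr_ge0 (x ^+ n); move: `|_| => a a0.
  have : 0 <= (a - 1) ^+ 2 by exact: sqr_ge0.
  rewrite sqrrB mulr1 expr1n; nra.
rewrite (le_trans h1)// mulrDl mul1r lerD ?exprn_le_expR ?sqr_ge0//.
by rewrite -expR0 ler_expR divr_ge0 ?sqr_ge0.
Qed.

Let mg : measurable_fun setT g.
Proof.
apply: measurableT_comp => //; apply: measurable_funM => //.
exact: measurableT_comp.
Qed.

Lemma integrable_exprn_gauss n :
  mu.-integrable setT (fun x => (x ^+ n * g x)%:E).
Proof.
have [C C0 hC] := exprn_gauss_bound n.
have s0 : (2 : R) != 0 by [].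
have pk := normal_peak_gt0 s0.
(* The dominating function is a multiple of the normal density of standard deviation 2, whose
   exponent - x^2 / 8 is above - x^2 / 4. *)
have i2 := @integrable_normal_pdf R 0 2.
have := integrableZl measurableT (C / normal_peak 2) i2.
apply: le_integrable => //.
  apply/measurable_EFinP/measurable_funM => //.
move=> x _; rewrite -EFinM !abse_EFin lee_fin (le_trans (hC x))//.
rewrite (le_trans _ (ler_norm _))//.
rewrite normal_pdfE//= /normal_fun subr0 mulrA divfK ?gt_eqF//.
rewrite ler_wpM2l// ler_expR !mulNr lerN2 ler_wpM2l ?sqr_ge0//.
have -> : (2 ^+ 2 *+ 2 : R) = 8 by ring.
by rewrite lef_pV2 ?posrE// ler_nat.
Qed.

(** The fundamental theorem of calculus on [-(n + 1), n + 1], then dominated convergence. The shift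
    by one keeps every interval nondegenerate. *)
Lemma integral_derive_eq0 (F f : R -> R) :
  continuous f -> (forall x : R, is_derive x (1 : R) F (f x)) ->
  mu.-integrable setT (EFin \o f) ->
  F n.+1%:R @[n --> \oo] --> (0 : R) -> F (- n.+1%:R) @[n --> \oo] --> (0 : R)
    ->
  (\int[mu]_x (f x)%:E = 0)%E.
Proof.
move=> cf dF fi Fy FNy.
pose I (n : nat) : set R := `[- n.+1%:R, n.+1%:R]%classic.
have FTC n : (\int[mu]_(x in I n) (f x)%:E = (F n.+1%:R - F (- n.+1%:R))%:E)%E.
  have cF : continuous F.
    move=> x; apply/differentiable_continuous/derivable1_diffP.
    exact: (@ex_derive _ _ _ _ _ _ _ (dF x)).
  rewrite (@continuous_FTC2 _ f F) ?EFinB//.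
  - by rewrite gtrN.
  - exact: continuous_subspaceT.
  - split=> [x _||].
    + exact: (@ex_derive _ _ _ _ _ _ _ (dF x)).
    + by apply: cvg_at_right_filter; exact: cF.
    + by apply: cvg_at_left_filter; exact: cF.
  - by move=> x _; rewrite derive1E; exact: (@derive_val _ _ _ _ _ _ _ (dF x)).
have cvg1 : (\int[mu]_(x in I n) (f x)%:E @[n --> \oo] --> 0)%E.
  under eq_fun do rewrite FTC.
  apply: cvg_EFin; first exact: nearW.
  by rewrite -(subr0 (0 : R)); exact: cvgB.
have mI n : measurable (I n) by exact: measurable_itv.
have [|||||_ _ cvg2] := @dominated_convergence _ _ _ mu setT measurableT
    (fun n => (EFin \o f) \_ (I n)) (EFin \o f) (abse \o (EFin \o f)).
- move=> n; apply/(measurable_restrictT _ _).1; first exact: mI.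
  by apply: measurable_funTS; exact: measurable_int fi.
- exact: measurable_int fi.
- apply: aeW => x _; apply: cvg_near_cst; near=> n.
  rewrite patchE mem_set// /I/= in_itv/= -ler_norml.
  by rewrite (@le_trans _ _ n%:R) ?ler_nat//; near: n; exact: nbhs_infty_ger.
- exact: integrable_abse.
- apply: aeW => x n _; rewrite patchE; case: ifPn => _ /=; first exact: lexx.
  by rewrite normr0 lee_fin.
have cvg3 : (\int[mu]_(x in I n) (f x)%:E @[n --> \oo] --> \int[mu]_x (f
  x)%:E)%E.
  by under eq_fun do rewrite integral_mkcond; exact: cvg2.
exact: (cvg_unique _ cvg3 cvg1).
Unshelve. all: by end_near. Qed.

Lemma is_derive_exprn_gauss n (x : R) :
  is_derive x (1 : R) (fun x => x ^+ n * g x)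
    (n%:R * (x ^+ n.-1 * g x) - x ^+ n.+1 * g x).
Proof.
have dq : is_derive x (1 : R) (fun x : R => - x ^+ 2 / 2) (- x).
  have -> : (fun x : R => - x ^+ 2 / 2) = (- 2^-1 : R) \*: (@id R ^+ 2).
    by apply/funext => y; rewrite [RHS](_ : _ = - 2^-1 * y ^+ 2)//; field.
  by apply: is_derive_eq; rewrite expr1 /GRing.scale/=; field.
have dg : is_derive x (1 : R) g (g x * (- x)).
  exact: (is_derive1_comp (is_derive_expR _) dq).
have dp : is_derive x (1 : R) (fun x : R => x ^+ n) (n%:R * x ^+ n.-1).
  have -> : (fun x : R => x ^+ n) = @id R ^+ n by apply/funext => y;
    rewrite fctE.
  by apply: is_derive_eq; rewrite /GRing.scale/= mulr1.
have -> : (fun x => x ^+ n * g x) = (fun x : R => x ^+ n) * g by [].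
by apply: is_derive_eq; rewrite /GRing.scale/= exprS; ring.
Qed.

Lemma exprn_gauss_cvg0 n (s : R) : `|s| = 1 ->
  (s * k.+1%:R) ^+ n * g (s * k.+1%:R) @[k --> \oo] --> (0 : R).
Proof.
(* Bounding one power more than required and dividing by |x| gives the explicit rate C / (k + 1). *)
move=> s1; have [C C0 hC] := exprn_gauss_bound n.+1.
apply: norm_cvg0; apply: (@squeeze_cvgr _ _ _ _ (cst 0) (fun k => C * harmonic
  k)).
- near=> k; rewrite normr_ge0/= /harmonic/=.
  have xk : `|s * k.+1%:R| = k.+1%:R :> R by rewrite normrM s1 mul1r normr_nat.
  move: (s * k.+1%:R) xk => x xk; rewrite ler_pdivlMr// mulrC -xk.
  rewrite -normrM mulrA -exprS (le_trans (hC _))// ler_piMr//.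
  by rewrite -expR0 ler_expR mulNr oppr_le0 divr_ge0 ?sqr_ge0.
- exact: cvg_cst.
- rewrite -(mulr0 C); apply: cvgM; [exact: cvg_cst|exact: cvg_harmonic].
Unshelve. all: by end_near. Qed.

(** Integration by parts: the integrand is the derivative of x^n g, which vanishes at both ends. At
    n = 0 the truncated exponent is multiplied by zero. *)
Lemma integral_exprn_gauss_rec n :
  (\int[mu]_x (n%:R * (x ^+ n.-1 * g x) - x ^+ n.+1 * g x)%:E = 0)%E.
Proof.
have cg : continuous g.
  move=> x; apply: differentiable_continuous; apply/derivable1_diffP.
  have := is_derive_exprn_gauss 0 x.
  have -> : (fun x => x ^+ 0 * g x) = g by apply/funext => y;
    rewrite expr0 mul1r.
  by case.
have cm m : continuous (fun x : R => x ^+ m * g x).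
  by move=> x; apply: cvgM; [exact: exprn_continuous|exact: cg].
apply: (@integral_derive_eq0 (fun x => x ^+ n * g x)).
- move=> x; apply: cvgB; last exact: cm.
  by apply: cvgM; [exact: cvg_cst|exact: cm].
- exact: is_derive_exprn_gauss.
- have i1 := integrable_exprn_gauss n.-1; have i2 := integrable_exprn_gauss
  n.+1.
  exact: integrableB (integrableZl measurableT n%:R i1) i2.
- have := @exprn_gauss_cvg0 n 1; rewrite normr1 => /(_ erefl).
  by under eq_fun do rewrite !mul1r.
- have := @exprn_gauss_cvg0 n (- 1); rewrite normrN1 => /(_ erefl).
  by under eq_fun do rewrite !mulN1r.
Qed.

(** The moments of N(0, 1): the double factorial of n - 1 for even n, and 0 for odd n. *)
Fixpoint gauss_moment (n : nat) : R :=
  match n with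
  | 0 => 1
  | 1 => 0
  | m.+2 => m.+1%:R * gauss_moment m
  end.

Let normal_integrand n x : ((x ^+ n)%:E * (normal_pdf 0 1 x)%:E)%E =
  ((normal_peak 1)%:E * (x ^+ n * g x)%:E)%E.
Proof. by rewrite pdfE -!EFinM mulrCA. Qed.

Lemma normal_prob_integrable_exprn n :
  N.-integrable setT (fun x => (x ^+ n)%:E).
Proof.
have mX : measurable_fun setT (fun x : R => (x ^+ n)%:E).
  by apply/measurable_EFinP; exact: measurable_funX.
apply/integrableP; split=> //.
rewrite ge0_integral_normal_prob//; last exact: measurableT_comp.
have /integrableP[_] := integrableZl measurableT (normal_peak 1)
  (integrable_exprn_gauss n).
congr (_ < _)%E; apply: eq_integral => x _.
rewrite -normal_integrand abseM; congr (_ * _)%E.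
by rewrite gee0_abs// lee_fin normal_pdf_ge0.
Qed.

Lemma normal_moment n : (\int[N]_x (x ^+ n)%:E = (gauss_moment n)%:E)%E.
Proof.
have mE m : (\int[N]_x (x ^+ m)%:E =
    (normal_peak 1)%:E * \int[mu]_x (x ^+ m * g x)%:E)%E.
  rewrite integral_normal_prob; last first.
    by apply/measurable_EFinP; exact: measurable_funX.
  rewrite -integralZl//; last exact: integrable_exprn_gauss.
  by apply: eq_integral => x _; exact: normal_integrand.
have rec m : (\int[mu]_x (x ^+ m.+1 * g x)%:E =
    m%:R%:E * \int[mu]_x (x ^+ m.-1 * g x)%:E)%E.
  have i1 := integrable_exprn_gauss m.-1; have i2 := integrable_exprn_gauss
    m.+1.
  have := integral_exprn_gauss_rec m.
  under eq_integral do rewrite EFinB EFinM.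
  rewrite integralB//; last exact: integrableZl.
  rewrite integralZl//.
  have := integrable_fin_num measurableT i1.
  have := integrable_fin_num measurableT i2.
  move: (\int[mu]_x _)%E (\int[mu]_x _)%E => a b.
  by case: a => // a _; case: b => // b _; rewrite -EFinM -EFinB => -[/eqP];
    rewrite subr_eq0 => /eqP ->.
elim/ltn_ind: n => -[|[|n]] IH /=.
- under eq_integral do rewrite expr0.
  by rewrite integral_cst// mul1e; exact: integral_normal_pdf.
- by rewrite mE rec mul0e mule0.
- by rewrite mE rec/= muleCA -mE IH// EFinM.
Qed.

End NormalMoments.

(** * Independence from a generating pi-system, and transfer of laws *)

Section GeneratedIndependence.
Context {R : realType} {d : measure_display} {S : measurableType d}.
Variable P : probability S R.

(** Both sides are finite measures in A that agree on a pi-system containing the whole space, hence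
    on the sigma-algebra it generates. *)
Lemma pi_system_indep (G : set (set S)) (D : set S) :
  setI_closed G -> G `<=` measurable -> G setT -> measurable D ->
  (forall A, G A -> P (A `&` D) = (P A * P D)%E) ->
  forall A, <<s G >> A -> P (A `&` D) = (P A * P D)%E.
Proof.
move=> GI Gm GT mD h A sGA.
have r0 : 0 <= fine (P D) by rewrite fine_ge0.
pose r := NngNum r0.
pose m1 := mrestr P mD; pose m2 := mscale r P.
have PD : (fine (P D))%:E = P D by rewrite fineK// fin_num_measure.
have m12 B : G B -> m1 B = m2 B.
  by move=> GB; rewrite /m1 /m2 /mrestr /mscale/= PD h// muleC.
suff : m1 A = m2 A by rewrite /m1 /m2 /mrestr /mscale/= PD muleC.
apply: (g_sigma_algebra_measure_unique G Gm (fun=> setT)) => //.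
- by rewrite bigcup_const//; exists 0.
- move=> _; rewrite /= /mrestr setTI (le_lt_trans (probability_le1 _ _))//.
  by rewrite ltry.
Qed.

End GeneratedIndependence.

Section LawTransfer.
Context {R : realType} {d : measure_display} {S : measurableType d}.
Variables (P : probability S R) (Q : probability (measurableTypeR R) R) (X : S
  -> measurableTypeR R).
Hypotheses (mX : measurable_fun setT X)
  (lawX : forall A, measurable A -> P (X @^-1` A) = Q A).

#[local] HB.instance Definition _ := isMeasurableFun.Build _ _ _ _ X mX.

Let lawE A : measurable A -> A `<=` setT -> distribution P X A = Q A.
Proof. by move=> mA _; exact: lawX. Qed.

Lemma law_integrable (f : measurableTypeR R -> \bar R) : Q.-integrable setT f ->
  P.-integrable setT (f \o X).
Proof.
move=> iQ; have mf := measurable_int _ iQ; apply/integrableP; split.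
  exact: measurableT_comp mf mX.
have /integrableP[_] := iQ; rewrite -(eq_measure_integral Q lawE)//.
rewrite (@ge0_integral_distribution _ _ _ _ _ P X (fun x => `|f x|%E))//.
exact: measurableT_comp.
Qed.

Lemma law_integral (f : measurableTypeR R -> \bar R) : Q.-integrable setT f ->
  (\int[P]_w f (X w) = \int[Q]_x f x)%E.
Proof.
move=> iQ; rewrite -(eq_measure_integral Q lawE)//.
by rewrite integral_distribution//; [exact: measurable_int iQ|exact:
  law_integrable].
Qed.

End LawTransfer.

(** * Joint moments of the coordinates of a standard Gaussian vector *)

Section GaussianMoments.
Context {R : realType} {dT : measure_display} {T : measurableType dT}.
Variables (P : probability T R) (d : nat) (u : T -> 'cV[R]_d).
Hypothesis u_gauss : std_gaussian P u.

Let mu_ i : measurable_fun setT (fun w => u w i ord0) := u_gauss.1 i.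

Let coord_law i B : measurable B ->
  P ((fun w => u w i ord0) @^-1` B) = normal_prob 0 1 B.
Proof.
move=> mB; pose B' j := if j == i then B else setT.
have mB' j : measurable (B' j) by rewrite /B'; case: ifP.
have := u_gauss.2 _ mB'; rewrite (bigD1 i)//= {2}/B' eqxx.
rewrite big1 ?mule1 => [<-|j /negPf ji]; last first.
  by rewrite /B' ji; exact: (@probability_setT _ _ _ (normal_prob 0 1)).
congr (P _); apply/seteqP; split => w /=.
  by move=> h j; rewrite /B'; case: eqP => // ->.
by move=> /(_ i); rewrite /B' eqxx.
Qed.

Lemma gaussian_coord_moment i n :
  P.-integrable setT (fun w => (u w i ord0 ^+ n)%:E) /\
  (\int[P]_w (u w i ord0 ^+ n)%:E = (gauss_moment n)%:E)%E.
Proof.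
have iN := @normal_prob_integrable_exprn R n.
have h1 := law_integrable (mu_ i) (coord_law i) iN.
have h2 := law_integral (mu_ i) (coord_law i) iN.
by split; [exact: h1|rewrite -normal_moment; exact: h2].
Qed.

Variable m : 'I_d -> nat.

Let Z n w := \prod_(i < d | (i < n)%N) u w i ord0 ^+ m i.

(** A pi-system generating the sigma-algebra of the first n coordinates. Intersecting such a box
    with a condition on coordinate n gives a box for n + 1, which is how the product formula of
    [std_gaussian] becomes independence. *)
Let box n : set (set T) := [set E | exists B : 'I_d -> set R,
  (forall i, measurable (B i)) /\
  E = [set w | forall i : 'I_d, (i < n)%N -> B i (u w i ord0)]].

Let box_law n (B : 'I_d -> set R) : (forall i, measurable (B i)) ->
  P [set w | forall i : 'I_d, (i < n)%N -> B i (u w i ord0)] =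
  (\prod_(i < d | (i < n)%N) normal_prob 0 1 (B i))%E.
Proof.
move=> mB; pose B' (i : 'I_d) := if (i < n)%N then B i else setT.
have mB' j : measurable (B' j) by rewrite /B'; case: ifP.
transitivity (P [set w | forall i, B' i (u w i ord0)]).
  congr (P _); apply/seteqP; split => w /= h i.
    by rewrite /B'; case: ifP => // /h.
  by move=> ni; have := h i; rewrite /B' ni.
rewrite (u_gauss.2 _ mB') [RHS]big_mkcond/=; apply: eq_bigr => i _.
by rewrite /B'; case: ifP => // _; exact: (@probability_setT _ _ _ (normal_prob
  0 1)).
Qed.

Let measurable_box n : box n `<=` measurable.
Proof.
move=> _ [B [mB ->]].
have -> : [set w | forall i : 'I_d, (i < n)%N -> B i (u w i ord0)] =
    \bigcap_(i in [set i : 'I_d | (i < n)%N]) (fun w => u w i ord0) @^-1` (B i).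
  by apply/seteqP; split => w.
apply: fin_bigcap_measurable; first exact: finite_finset.
by move=> i _; rewrite -[X in measurable X]setTI; exact: mu_.
Qed.

Let setI_box n : setI_closed (box n).
Proof.
move=> _ _ [B [mB ->]] [C [mC ->]]; exists (fun i => B i `&` C i); split.
  by move=> i; exact: measurableI.
apply/seteqP; split => w /=.
  by move=> [h1 h2] i ni; split; [exact: h1|exact: h2].
by move=> h; split=> i ni; have [] := h i ni.
Qed.

Let setT_box n : box n setT.
Proof. by exists (fun=> setT); split => //; apply/seteqP; split. Qed.

Let box_indep n (ltnd : (n < d)%N) A C : <<s box n >> A -> measurable C ->
  let D := (fun w => u w (Ordinal ltnd) ord0) @^-1` C in
  P (A `&` D) = (P A * P D)%E.
Proof.
move=> sA mC D; apply: (pi_system_indep (@setI_box n)) sA => //.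
  by rewrite -[X in measurable X]setTI; exact: mu_.
move=> _ [B [mB ->]].
pose B' i := if i == Ordinal ltnd then C else B i.
have mB' j : measurable (B' j) by rewrite /B'; case: ifP.
rewrite coord_law// box_law//.
transitivity (P [set w | forall i : 'I_d, (i < n.+1)%N -> B' i (u w i ord0)]).
  congr (P _); apply/seteqP; split => w /=.
    move=> [h1 h2] i; rewrite ltnS leq_eqVlt /B' => /orP[/eqP e|ni].
      have -> : i = Ordinal ltnd by exact: val_inj.
      by rewrite eqxx.
    have -> : (i == Ordinal ltnd) = false.
      by apply/negbTE; rewrite -val_eqE/= ltn_eqF.
    exact: h1.
  move=> h; split=> [i ni|].
    have := h i (ltnW ni); rewrite /B' ifF//.
    by apply/negbTE; rewrite -val_eqE/= ltn_eqF.
  by have := h (Ordinal ltnd) (leqnn _); rewrite /B' eqxx.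
rewrite box_law// (bigD1 (Ordinal ltnd))//= {1}/B' eqxx muleC.
congr (_ * _)%E; apply: eq_big => [i|i /andP[_ /negPf ni]];
  last by rewrite /B' ni.
by rewrite ltnS -val_eqE/= ltn_neqAle andbC.
Qed.

Let ZS n (ltnd : (n < d)%N) w :
  Z n.+1 w = Z n w * u w (Ordinal ltnd) ord0 ^+ m (Ordinal ltnd).
Proof.
rewrite /Z (bigD1 (Ordinal ltnd))//= mulrC; congr (_ * _).
by apply: eq_bigl => i; rewrite ltnS -val_eqE/= ltn_neqAle andbC.
Qed.

Let measurable_Z n : measurable_fun setT (Z n : g_sigma_algebraType (box n) ->
  R).
Proof.
have -> : Z n = fun w => \prod_(i < d) (if (i < n)%N then u w i ord0 ^+ m i else
  1).
  by apply/funext => w; rewrite /Z big_mkcond.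
apply: measurable_prod => i _; have [ni|_] := boolP (i < n)%N;
  last exact: measurable_cst.
apply: measurable_funX => _ B mB; rewrite setTI; apply: sub_sigma_algebra.
exists (fun j => if j == i then B else setT); split.
  by move=> j; case: ifP.
apply/seteqP; split => w /=.
  by move=> h j nj; case: eqP => // ->.
by move=> /(_ i ni); rewrite eqxx.
Qed.

Let Z_indep n (ltnd : (n < d)%N) :
  indep_rv P (Z n) (fun w => u w (Ordinal ltnd) ord0 ^+ m (Ordinal ltnd)).
Proof.
move=> A B mA mB.
have -> : (fun w => u w (Ordinal ltnd) ord0 ^+ m (Ordinal ltnd)) @^-1` B =
  (fun w => u w (Ordinal ltnd) ord0) @^-1`
     ((fun x => x ^+ m (Ordinal ltnd)) @^-1` B) by [].
apply: box_indep.
  by rewrite -[X in <<s _ >> X]setTI; exact: measurable_Z.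
by rewrite -[X in measurable X]setTI; exact: measurable_funX.
Qed.

(** Coordinates are multiplied in one at a time; integrability is carried through the induction
    because the product rule requires it of both factors. *)
Lemma gaussian_prod_moment :
  P.-integrable setT (fun w => (\prod_(i < d) u w i ord0 ^+ m i)%:E) /\
  \int[P]_w (\prod_(i < d) u w i ord0 ^+ m i) = \prod_(i < d) gauss_moment (m
    i).
Proof.
suff : forall n, (n <= d)%N -> P.-integrable setT (fun w => (Z n w)%:E) /\
    \int[P]_w (Z n w) = \prod_(i < d | (i < n)%N) gauss_moment (m i).
  move=> /(_ d (leqnn d)) [h1 h2].
  have Zd : Z d = fun w => \prod_(i < d) u w i ord0 ^+ m i.
    by apply/funext => w; apply: eq_bigl => i; rewrite ltn_ord.
  rewrite Zd in h1 h2; split; first exact: h1.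
  by rewrite h2; apply: eq_bigl => i; rewrite ltn_ord.
elim=> [_|n IH ltnd].
  have -> : Z 0%N = cst 1 by apply/funext => w; rewrite /Z big1.
  split; last first.
    rewrite Rintegral_cst// big1// mul1r.
    exact: (congr1 fine (probability_setT P)).
  exact: finite_measure_integrable_cst.
have [i1 e1] := IH (ltnW ltnd).
have [i2 e2] := gaussian_coord_moment (Ordinal ltnd) (m (Ordinal ltnd)).
have mZ : measurable_fun setT (Z n) by exact/measurable_EFinP/(measurable_int _
  i1).
have mX : measurable_fun setT (fun w => u w (Ordinal ltnd) ord0 ^+ m (Ordinal
  ltnd)).
  exact: measurable_funX.
have -> : Z n.+1 = fun w => Z n w * u w (Ordinal ltnd) ord0 ^+ m (Ordinal ltnd).
  by apply/funext => w; exact: ZS.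
split; first exact: indep_integrable (@Z_indep n ltnd) i1 i2.
rewrite (indep_Rintegral mZ mX (@Z_indep n ltnd) i1 i2) e1 [X in _ *
  X]/Rintegral e2/=.
rewrite [RHS](bigD1 (Ordinal ltnd))//= mulrC; congr (_ * _).
by apply: eq_bigl => i; rewrite ltnS -val_eqE/= ltn_neqAle andbC.
Qed.

End GaussianMoments.

(** * Gaussian monomials and Isserlis' formula *)

Section Wick.
Context {R : realType} {d : nat}.
Implicit Types (s : seq 'I_d) (i : 'I_d) (B K : 'M[R]_d).

(* The expectation of [\prod_(i <- s) u_i] for [u ~ N(0, I_d)]. *)
Definition wick s : R := \prod_(i < d) gauss_moment (count_mem i s).

Lemma gauss_momentS n : gauss_moment n.+1 = n%:R * gauss_moment n.-1 :> R.
Proof. by case: n => //=; rewrite mul0r. Qed.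

Lemma wick_nil : wick [::] = 1.
Proof. by rewrite /wick big1. Qed.

(** Isserlis' recursion: the first letter is paired with each later occurrence of itself. It is the
    recursion of [gauss_moment] in the coordinate i. *)
Lemma wick_cons i s : wick (i :: s) = (count_mem i s)%:R * wick (rem i s).
Proof.
rewrite /wick (bigD1 i)//= [in RHS](bigD1 i)//= eqxx add1n gauss_momentS mulrA.
rewrite count_mem_rem eqxx subn1; congr (_ * _); apply: eq_bigr => j /negPf ji.
by rewrite count_mem_rem /= [i == j]eq_sym ji subn0.
Qed.

Lemma wick2 i j : wick [:: i; j] = (i == j)%:R.
Proof.
rewrite wick_cons /= addn0 eq_sym; case: eqP => _; last by rewrite mul0r.
by rewrite wick_nil mulr1.
Qed.

Lemma wick4 a b c e : wick [:: a; b; c; e] =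
  (a == b)%:R * (c == e)%:R + (a == c)%:R * (b == e)%:R +
  (a == e)%:R * (b == c)%:R.
Proof.
rewrite wick_cons/= ![_ == a]eq_sym.
have [<-|/negPf ab] := eqVneq a b; have [<-|/negPf ac] := eqVneq a c;
  have [<-|/negPf ae] := eqVneq a e;
  rewrite ?eqxx /= ?eqxx /= ?wick2 ?eqxx ?[_ == a]eq_sym ?ab ?ac ?ae /=; ring.
Qed.

Lemma wick_double i s : wick [:: i, i & s] = (1 + (count_mem i s)%:R) * wick s.
Proof. by rewrite wick_cons/= eqxx natrD. Qed.

(** The sum over i inserts a factor |u|^2 under the expectation. The counts of all letters in s add
    up to its length. *)
Lemma sum_wick_double s :
  \sum_i wick [:: i, i & s] = (d + size s)%:R * wick s.
Proof.
under eq_bigr do rewrite wick_double.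
rewrite -mulr_suml big_split/= sumr_const card_ord natrD; congr ((_ + _) * _).
rewrite -natr_sum; congr (_%:R); elim: s => [|j s IH] /=; first by rewrite big1.
rewrite big_split/= IH -add1n; congr (_ + _)%N.
by rewrite (bigD1 j)//= eqxx big1// => i /negPf; rewrite eq_sym => ->.
Qed.

Lemma sum_delta (F : 'I_d -> R) i : \sum_j (i == j)%:R * F j = F i.
Proof.
rewrite (bigD1 i)//= eqxx mul1r big1 ?addr0// => j /negPf.
by rewrite eq_sym => ->; rewrite mul0r.
Qed.

Lemma sum_wick2 B : \sum_a \sum_b B a b * wick [:: a; b] = \tr B.
Proof.
apply: eq_bigr => a _; under eq_bigr do rewrite wick2 mulrC.
exact: sum_delta.
Qed.

(** The expectation of (u^T B u) (u^T K u): one term for each of the three pairings of four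
    letters. *)
Lemma sum_wick4 B K :
  \sum_a \sum_b \sum_c \sum_e B a b * K c e * wick [:: a; b; c; e] =
  \tr B * \tr K + fdot B K + fdot B K^T.
Proof.
have inner a b : \sum_c \sum_e B a b * K c e * wick [:: a; b; c; e] =
    (a == b)%:R * (B a b * \tr K) + B a b * K a b + B a b * K b a.
  transitivity (\sum_c ((a == b)%:R * (B a b * K c c) +
      (a == c)%:R * (B a b * K c b) + (b == c)%:R * (B a b * K c a))).
    apply: eq_bigr => c _.
    transitivity (\sum_e ((c == e)%:R * ((a == b)%:R * (B a b * K c e)) +
       (b == e)%:R * ((a == c)%:R * (B a b * K c e)) +
       (a == e)%:R * ((b == c)%:R * (B a b * K c e)))).
      by apply: eq_bigr => e _; rewrite wick4; ring.
    by rewrite !big_split/= !sum_delta.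
  by rewrite !big_split/= !sum_delta -!mulr_sumr.
under eq_bigr do under eq_bigr do rewrite inner.
under eq_bigr do rewrite !big_split/= sum_delta.
rewrite !big_split/= -mulr_suml; congr (_ + _).
by apply: eq_bigr => a _; apply: eq_bigr => b _; rewrite mxE.
Qed.

Lemma prod_count s (f : 'I_d -> R) :
  \prod_(i <- s) f i = \prod_(i < d) f i ^+ count_mem i s.
Proof.
elim: s => [|a s IH]; first by rewrite big_nil big1.
rewrite big_cons IH /=; under [RHS]eq_bigr do rewrite exprD.
rewrite big_split/=; congr (_ * _).
rewrite (bigD1 a)//= eqxx expr1 big1 ?mulr1// => i /negPf.
by rewrite eq_sym => ->.
Qed.

Lemma quad_formE B (v : 'cV[R]_d) :
  fdot v (B *m v) = \sum_a \sum_b B a b * (v a ord0 * v b ord0).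
Proof.
apply: eq_bigr => a _; rewrite big_ord1 mxE mulr_sumr.
by apply: eq_bigr => b _; rewrite mulrCA.
Qed.

End Wick.

(** * Expectations of Gaussian monomials with random coefficients *)

Section Expectations.
Context {R : realType} {dS : measure_display} {S : measurableType dS}.
Variable P : probability S R.

Lemma Rintegral_sum (I : Type) (r : seq I) (f : I -> S -> R) :
  (forall i, P.-integrable setT (EFin \o f i)) ->
  P.-integrable setT (EFin \o (fun w => \sum_(i <- r) f i w)) /\
  \int[P]_w (\sum_(i <- r) f i w) = \sum_(i <- r) \int[P]_w f i w.
Proof.
move=> fi; elim: r => [|i r [IHi IHe]].
  have -> : (fun w => \sum_(i <- [::]) f i w) = cst 0.
    by apply/funext => w; rewrite big_nil.
  by split; [exact: finite_measure_integrable_cst|rewrite Rintegral_cst// mul0r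
    big_nil].
have -> : (fun w => \sum_(i <- i :: r) f i w) =
    (fun w => f i w + \sum_(i <- r) f i w).
  by apply/funext => w; rewrite big_cons.
split; first exact: (integrableD measurableT (fi i) IHi).
by rewrite RintegralD// IHe big_cons.
Qed.

Lemma bounded_integrable (f : S -> R) (c : R) : measurable_fun setT f ->
  (forall w, `|f w| <= c) -> P.-integrable setT (EFin \o f).
Proof.
move=> mf fc; have := finite_measure_integrable_cst P c measurableT.
apply: le_integrable => //; first exact/measurable_EFinP.
by move=> w _; rewrite !abse_EFin lee_fin (le_trans (fc w))// ler_norm.
Qed.

Context {d : nat}.
Variable u : S -> 'cV[R]_d.
Hypothesis u_gauss : std_gaussian P u.

Definition word (s : seq 'I_d) (w : S) : R := \prod_(i <- s) u w i ord0.

Lemma word_moment s : P.-integrable setT (EFin \o word s) /\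
  \int[P]_w word s w = wick s.
Proof.
have [h1 h2] := gaussian_prod_moment u_gauss (fun i => count_mem i s).
have -> : word s = fun w => \prod_(i < d) u w i ord0 ^+ count_mem i s.
  by apply/funext => w; exact: prod_count.
by [].
Qed.

(** Only the empty word is needed later. The general s makes the induction work, since expanding one
    factor |u|^2 prepends two letters to the word. *)
Lemma normsq_word_moment k s :
  P.-integrable setT (EFin \o (fun w => fdot (u w) (u w) ^+ k * word s w)) /\
  \int[P]_w (fdot (u w) (u w) ^+ k * word s w) =
    (\prod_(j < k) (d + size s + 2 * j)%:R) * wick s.
Proof.
elim: k s => [|k IH] s.
  have [h1 h2] := word_moment s.
  have -> : (fun w => fdot (u w) (u w) ^+ 0 * word s w) = word s.
    by apply/funext => w; rewrite expr0 mul1r.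
  by rewrite big_ord0 mul1r.
have -> : (fun w => fdot (u w) (u w) ^+ k.+1 * word s w) =
    fun w => \sum_(i < d) fdot (u w) (u w) ^+ k * word [:: i, i & s] w.
  apply/funext => w; rewrite exprSr -mulrA -mulr_sumr; congr (_ * _).
  rewrite {1}/fdot mulr_suml; apply: eq_bigr => i _.
  by rewrite big_ord1 /word !big_cons mulrA.
have [h1 h2] := Rintegral_sum (index_enum 'I_d)
  (fun i => (IH [:: i, i & s]).1).
split; first exact: h1.
rewrite h2; under eq_bigr do rewrite (IH _).2 /=.
rewrite -mulr_sumr sum_wick_double mulrA big_ord_recl; congr (_ * _).
rewrite mulrC muln0 addn0; congr (_ * _); apply: eq_bigr => j _.
by rewrite /= /bump leq0n add1n mulnS; congr (_%:R); lia.
Qed.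

Variable G : set (set S).
Hypothesis G_measurable : G `<=` measurable.
Hypothesis G_indep : forall s A C, <<s G >> A -> measurable C ->
  P (A `&` word s @^-1` C) = (P A * P (word s @^-1` C))%E.

Lemma sub_sigma_measurable (f : S -> R) :
  measurable_fun setT (f : g_sigma_algebraType G -> R) -> measurable_fun setT f.
Proof.
move=> mf _ B mB; have := mf measurableT _ mB; rewrite !setTI.
exact: (smallest_sub (@sigma_algebra_measurable _ S) G_measurable).
Qed.

(** The right-hand side stays an integral of a random sum, rather than a sum of products of means,
    so that this sum can be evaluated pointwise in the matrices afterwards. *)
Lemma random_coef_mean (I : finType) (f : I -> S -> R) (c : R)
    (s : I -> seq 'I_d) :
  (forall i, measurable_fun setT (f i : g_sigma_algebraType G -> R)) ->
  (forall i w, `|f i w| <= c) ->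
  P.-integrable setT (EFin \o (fun w => \sum_i f i w * word (s i) w)) /\
  \int[P]_w (\sum_i f i w * word (s i) w) =
  \int[P]_w (\sum_i f i w * wick (s i)).
Proof.
move=> mf fc.
have mf' i := sub_sigma_measurable (mf i).
have fi i : P.-integrable setT (EFin \o f i) := bounded_integrable (mf' i) (fc
  i).
have ind i : indep_rv P (f i) (word (s i)).
  move=> A B mA mB; apply: G_indep => //.
  by rewrite -[X in <<s _ >> X]setTI; exact: mf.
have [wi we] := all_and2 (fun i => word_moment (s i)).
have mw i : measurable_fun setT (word (s i)).
  exact/measurable_EFinP/(measurable_int _ (wi i)).
have [h1 h2] := Rintegral_sum (index_enum I)
  (fun i => indep_integrable (mf' i) (mw i) (ind i) (fi i) (wi i)).
split; first exact: h1.
rewrite h2; have [_ ->] := Rintegral_sum (index_enum I)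
   (fun i => integrableZr measurableT (wick (s i)) (fi i)).
apply: eq_bigr => i _; rewrite (indep_Rintegral (mf' i) (mw i) (ind i) (fi i)
  (wi i)).
by rewrite we RintegralZr.
Qed.

End Expectations.

(** * One step of the algorithm *)

Section QuadraticObjective.
Context {R : realType} {d : nat}.
Implicit Types (x y v : 'cV[R]_d).

(** On a line the difference quotient is a + h c exactly, so gradient and Hessian can be read off
    from the expansion in h. *)
Lemma derive_quadratic_line (g : 'cV[R]_d -> R) x v (a c : R) :
  (forall h, g (h *: v + x) = g x + h * a + h ^+ 2 * c) -> 'D_v g x = a.
Proof.
move=> hg; rewrite /derive; apply/cvg_lim => //.
apply: (@cvg_trans _ ((fun h : R => a + h * c) @ (0 : R)^')).
  apply: near_eq_cvg; near=> h.
  have h0 : h != 0 by near: h; exact: nbhs_dnbhs_neq.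
  rewrite /= hg; have -> : g x + h * a + h ^+ 2 * c - g x = h * (a + h * c).
    by ring.
  by rewrite /GRing.scale/= mulKf.
have : (fun h : R => a + h * c) @ (0 : R) --> a + 0 * c.
  by apply: cvgD; [exact: cvg_cst|apply: cvgM; [exact: cvg_id|exact: cvg_cst]].
rewrite mul0r addr0; apply: cvg_trans; apply: cvg_app; exact: nbhs_dnbhs.
Unshelve. all: by end_near. Qed.

Lemma fdot_delta y i : fdot (delta_mx i ord0) y = y i ord0.
Proof.
rewrite /fdot (bigD1 i)//= big_ord1 mxE !eqxx mul1r big1 ?addr0// => j /negPf
  ji.
by rewrite big_ord1 mxE ji mul0r.
Qed.

Variable f : 'cV[R]_d -> R.
Variables (A : 'M[R]_d) (b : 'cV[R]_d) (c : R).
Hypothesis fE : forall x, f x = dotv x (A *m x) + dotv b x + c.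

Let fline x v h : f (h *: v + x) =
  f x + h * fdot v ((A + A^T) *m x + b) + h ^+ 2 * fdot v (A *m v).
Proof.
rewrite !fE !dotv_fdot mulmxDr mulmxDl -scalemxAr !fdotE (fdotC b v).
by rewrite -(fdotC (A^T *m x)) fdot_mull trmxK; ring.
Qed.

Lemma gradient_quadratic x : gradient f x = (A + A^T) *m x + b.
Proof.
apply/colP => i; rewrite mxE -[RHS]fdot_delta.
exact: (derive_quadratic_line (fline x _)).
Qed.

Lemma hessian_quadratic x : hessian f x = A + A^T.
Proof.
apply/matrixP => i j; rewrite mxE.
have -> : (A + A^T) i j = ((A + A^T) *m delta_mx i (ord0 : 'I_1)) j ord0.
  by rewrite -colE !mxE addrC.
apply: (@derive_quadratic_line _ _ _ _ 0) => h.
by rewrite !gradient_quadratic mulmxDr -scalemxAr !mxE; ring.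
Qed.

Lemma second_difference x v (t : R) :
  f (x - t *: v) + f (x + t *: v) - 2 * f x = t ^+ 2 * fdot v ((A + A^T) *m v).
Proof.
rewrite (addrC x (t *: v)) (addrC x (- _)) -scaleNr !fline !mulmxDl.
rewrite !fdotDr (fdotC v (A^T *m v)) fdot_mull trmxK; ring.
Qed.

Lemma lsmooth_quadratic L x : lsmooth L f ->
  fdot x ((A + A^T) *m x) <= L * fdot x x.
Proof.
move=> [_ /(_ x 0)]; rewrite !gradient_quadratic mulmx0 add0r addrK subr0 => h.
rewrite (le_trans (fdot_le_frobenius _ _))// -frobenius_sqr expr2 mulrCA.
by rewrite ler_wpM2l ?frobenius_ge0.
Qed.

(** At y = 0 the left side of the convexity inequality exceeds the linear term by x^T A x, which is
    half of the Hessian form. *)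
Lemma strongly_convex_quadratic sigma x : 0 <= sigma -> strongly_convex sigma f
  ->
  0 <= fdot x ((A + A^T) *m x).
Proof.
move=> s0 /(_ x 0); rewrite gradient_quadratic mulmx0 add0r subr0 !fE
  !dotv_fdot.
rewrite frobenius_sqr mulmx0 mulmxDl fdotDr (fdotC x (A^T *m x)) fdot_mull
  trmxK.
have z n (y : 'M[R]_(d, n)) : fdot y 0 = 0.
  by rewrite -(scale0r y) fdotZr mul0r.
rewrite !z => h; have : 0 <= sigma / 2 * fdot x x.
  by rewrite mulr_ge0 ?divr_ge0 ?fdot_ge0.
lra.
Qed.

End QuadraticObjective.

Lemma quadratic_hessian_specset (R : realType) (d : nat) (L sigma : R)
    (f : 'cV[R]_d -> R) (H : 'M[R]_d) :
  0 < sigma -> quadratic f -> (forall x, hessian f x = H) -> lsmooth L f ->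
  strongly_convex sigma f ->
  specset 0 L H /\ forall x v t,
    f (x - t *: v) + f (x + t *: v) - 2 * f x = t ^+ 2 * fdot v (H *m v).
Proof.
move=> s0 [A [b [c fE]]] fH fL fc.
have HE : H = A + A^T by rewrite -(fH 0) (hessian_quadratic fE).
rewrite HE; split; last exact: second_difference fE.
split=> [|x]; first by rewrite linearD/= trmxK addrC.
rewrite mul0r (strongly_convex_quadratic fE x (ltW s0) fc).
by rewrite (lsmooth_quadratic fE x fL).
Qed.

(** Moved across the inner product, the outer factors S cancel against Q. This is why the estimator
    is unbiased whatever the current matrix is. *)
Lemma fdot_conj_inverse (R : realType) (d : nat) (S Q A B : 'M[R]_d) :
  S^T = S -> S *m Q = 1%:M -> Q *m S = 1%:M ->
  fdot (S *m A *m S) (Q *m B *m Q) = fdot B A.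
Proof.
move=> sS SQ QS; rewrite fdot_mulr sS fdot_mull sS -!mulmxA QS mulmx1.
by rewrite mulmxA SQ mul1mx fdotC.
Qed.

(** * Pointwise identities and bounds for a single update *)

Section OneStep.
Context {R : realType} {d : nat}.
Variables (tau zeta L : R) (H : 'M[R]_d).
Hypotheses (tau_gt0 : 0 < tau) (tau_le_zeta : tau <= zeta).
Hypothesis H_spec : specset 0 L H.

Let zeta_gt0 : 0 < zeta. Proof. exact: lt_le_trans tau_le_zeta. Qed.
Let z'_gt0 : 0 < zeta^-1. Proof. by rewrite invr_gt0. Qed.
Let z't' : zeta^-1 <= tau^-1. Proof. by rewrite lef_pV2. Qed.
Let t'_ge0 : 0 <= tau^-1. Proof. by rewrite invr_ge0 ltW. Qed.

Variable X : 'M[R]_d.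
Hypothesis X_spec : specset tau zeta X.

Definition mines_root : 'M[R]_d := sqrtmx (invmx X).
Let S := mines_root.
(** Written as S X rather than as an inverse, so that its measurability is that of a product;
    [mines_invrootE] identifies the two. *)
Definition mines_invroot : 'M[R]_d := S *m X.
Let Q := mines_invroot.

Let S_props := sqrtmxP z'_gt0 z't' (specset_inv tau_gt0 tau_le_zeta X_spec).
Let uX : X \in unitmx := specset_unit tau_gt0 X_spec.

Lemma mines_root_sym : S^T = S. Proof. by have [] := S_props. Qed.

Lemma mines_root_mul : S *m S = invmx X. Proof. by have [] := S_props. Qed.

Let SQ : S *m Q = 1%:M. Proof. by rewrite mulmxA mines_root_mul mulVmx. Qed.

Let uS : S \in unitmx.
Proof. by have [] := mulmx1_unit SQ. Qed.

Lemma mines_invrootE : Q = invmx S.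
Proof. by rewrite -[Q](mulKmx uS) SQ mulmx1. Qed.

Lemma mines_invroot_sym : Q^T = Q.
Proof. by rewrite mines_invrootE trmx_inv mines_root_sym. Qed.

Let QS : Q *m S = 1%:M. Proof. by rewrite mines_invrootE mulVmx. Qed.

Lemma mines_invroot_mul : Q *m Q = X.
Proof. by rewrite {2}/Q /mines_invroot mulmxA QS mul1mx. Qed.

Lemma mines_root_bound n (Z : 'M[R]_(d, n)) :
  fdot (S *m Z) (S *m Z) <= tau^-1 * fdot Z Z.
Proof.
rewrite fdot_mull mines_root_sym mulmxA mines_root_mul.
exact: specset_ub (specset_inv tau_gt0 tau_le_zeta X_spec).
Qed.

Lemma mines_invroot_bound n (Z : 'M[R]_(d, n)) :
  fdot (Q *m Z) (Q *m Z) <= zeta * fdot Z Z.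
Proof.
by rewrite fdot_mull mines_invroot_sym mulmxA mines_invroot_mul (specset_ub _
  X_spec).
Qed.

Lemma mines_invroot_bound2 (Z : 'M[R]_d) :
  fdot (Q *m Z *m Q) (Q *m Z *m Q) <= zeta ^+ 2 * fdot Z Z.
Proof.
rewrite -mulmxA (le_trans (mines_invroot_bound _))// expr2 -mulrA.
rewrite ler_wpM2l ?(ltW zeta_gt0)// -fdot_trmx trmx_mul mines_invroot_sym.
by rewrite (le_trans (mines_invroot_bound _))// fdot_trmx.
Qed.

Lemma mines_root_bound2 (Z : 'M[R]_d) :
  fdot (S *m Z *m S) (S *m Z *m S) <= tau^-1 ^+ 2 * fdot Z Z.
Proof.
rewrite -mulmxA (le_trans (mines_root_bound _))// expr2 -mulrA.
rewrite ler_wpM2l// -fdot_trmx trmx_mul mines_root_sym.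
by rewrite (le_trans (mines_root_bound _))// fdot_trmx.
Qed.

Definition mines_W (u : 'cV[R]_d) : 'M[R]_d :=
  (2^-1 * fdot u ((S *m H *m S) *m u)) *: (Q *m (u *m u^T) *m Q - X).

(** The draw enters only through two quadratic forms, so <C, W> is a polynomial of degree 4 in u
    whose coefficients depend on X and C alone. *)
Lemma fdot_mines_W (C : 'M[R]_d) u :
  fdot C (mines_W u) = 2^-1 *
    (fdot u ((S *m H *m S) *m u) * fdot u ((Q *m C *m Q) *m u)
     - \tr (Q *m C *m Q) * fdot u ((S *m H *m S) *m u)).
Proof.
have e1 : fdot C (Q *m (u *m u^T) *m Q) = fdot u ((Q *m C *m Q) *m u).
  rewrite fdotC fdot_mulr mines_invroot_sym fdot_mull mines_invroot_sym.
  by rewrite fdot_mulr trmxK !mulmxA.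
have e2 : fdot C X = \tr (Q *m C *m Q).
  transitivity (fdot (Q *m Q) C); first by rewrite mines_invroot_mul fdotC.
  rewrite fdot_mull mines_invroot_sym -[X in fdot X _](mul1mx Q) fdot_mulr.
  by rewrite mines_invroot_sym fdot_tr trmx1 mul1mx.
by rewrite /mines_W fdotZr fdotDr fdotNr e1 e2; ring.
Qed.

Lemma fdot_root_conj (C : 'M[R]_d) :
  fdot (S *m H *m S) (Q *m C *m Q) = fdot C H.
Proof. exact: fdot_conj_inverse mines_root_sym SQ QS. Qed.

(** The scalar factor is at most L |u|^2 / (2 tau). Since X = Q Q, the matrix factor is Q (u u^T -
    I) Q, and conjugation by Q costs zeta^2 in squared norm. The last factor is |u u^T - I|^2. *)
Lemma mines_W_bound u : fdot (mines_W u) (mines_W u) <=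
  L ^+ 2 * zeta ^+ 2 / (4 * tau ^+ 2) *
    (fdot u u ^+ 2 * (fdot u u ^+ 2 - 2 * fdot u u + d%:R)).
Proof.
rewrite /mines_W; set q := fdot u _.
have qE : q = fdot (S *m u) (H *m (S *m u)).
  by rewrite fdot_mull mines_root_sym !mulmxA.
have hs := mines_root_bound u.
have q0 : 0 <= q by rewrite qE (le_trans _ (specset_lb _ H_spec))// mul0r.
have qL : q <= L * fdot (S *m u) (S *m u) by rewrite qE (specset_ub _ H_spec).
have q2 : q ^+ 2 <= L ^+ 2 * (tau^-1 ^+ 2 * fdot u u ^+ 2).
  apply: (@le_trans _ _ ((L * fdot (S *m u) (S *m u)) ^+ 2)).
    by rewrite ler_pXn2r// nnegrE ?(le_trans q0).
  rewrite exprMn ler_wpM2l ?sqr_ge0// -exprMn ler_pXn2r// nnegrE ?fdot_ge0//.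
  by rewrite mulr_ge0 ?fdot_ge0.
have e : Q *m (u *m u^T) *m Q - X = Q *m (u *m u^T - 1%:M) *m Q.
  by rewrite mulmxBr mulmxBl mulmx1 mines_invroot_mul.
have hQ := mines_invroot_bound2 (u *m u^T - 1%:M).
have nE : fdot (u *m u^T - 1%:M) (u *m u^T - 1%:M) =
    fdot u u ^+ 2 - 2 * fdot u u + d%:R.
  have e1 : fdot (u *m u^T) (u *m u^T) = fdot u u ^+ 2.
    rewrite fdot_mulr trmxK -mulmxA.
    have -> : u^T *m u = (fdot u u)%:M.
      rewrite [LHS]mx11_scalar; congr _%:M.
      by rewrite -dotv_fdot.
    by rewrite mul_mx_scalar fdotZr expr2.
  have e2 : fdot (u *m u^T) 1%:M = fdot u u by rewrite fdot_mulr trmxK mul1mx.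
  rewrite fdotDl !fdotDr !fdotNl !fdotNr opprK fdot_scalar e1 e2.
  by rewrite (fdotC 1%:M) e2; ring.
rewrite e fdotZl fdotZr mulrA -expr2 exprMn.
have -> : L ^+ 2 * zeta ^+ 2 / (4 * tau ^+ 2) *
    (fdot u u ^+ 2 * (fdot u u ^+ 2 - 2 * fdot u u + d%:R)) =
  2^-1 ^+ 2 * ((L ^+ 2 * (tau^-1 ^+ 2 * fdot u u ^+ 2)) *
   (zeta ^+ 2 * (fdot u u ^+ 2 - 2 * fdot u u + d%:R))).
  by field; rewrite gt_eqF.
rewrite -(mulrA (2^-1 ^+ 2)) ler_wpM2l ?sqr_ge0//; apply: ler_pM => //.
- exact: sqr_ge0.
- exact: fdot_ge0.
- by rewrite -nE.
Qed.

Lemma fdot_hessian_ge0 : 0 <= fdot X H.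
Proof.
rewrite -mines_invroot_mul fdot_mulr mines_invroot_sym.
by rewrite (le_trans _ (specset_lb _ H_spec))// mul0r.
Qed.

(** C gathers everything linear in W: the cross term with X - P, and the cross term inside |W -
    X|^2. *)
Lemma mines_step_expand (P C W : 'M[R]_d) (eta : R) :
  C = (2 * eta - 2 * eta ^+ 2) *: X - (2 * eta) *: P ->
  fdot (X + eta *: (W - X) - P) (X + eta *: (W - X) - P) =
  fdot (X - P) (X - P) - 2 * eta * fdot (X - P) X + fdot C W
    + eta ^+ 2 * (fdot W W + fdot X X).
Proof.
move=> ->; rewrite !fdotE (fdotC P X) (fdotC W X) (fdotC W P); ring.
Qed.

(** With H in place of W the left side is |X - P|^2 + 2 eta <X - P, H - X> - 2 eta^2 <X, H>. The
    obtuse angle at P bounds the middle term, and <X, H> >= 0 disposes of the last. *)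
Lemma mines_mean_decrease (C : 'M[R]_d) (eta : R) : 0 <= eta ->
  let P := proj_prec tau zeta H in
  C = (2 * eta - 2 * eta ^+ 2) *: X - (2 * eta) *: P ->
  fdot (X - P) (X - P) - 2 * eta * fdot (X - P) X + fdot C H <=
  (1 - 2 * eta) * fdot (X - P) (X - P).
Proof.
move=> eta0 P ->; have := proj_prec_obtuse tau_gt0 tau_le_zeta H X_spec.
rewrite -/P => obt; have h := mulr_ge0 (sqr_ge0 eta) fdot_hessian_ge0.
have := mulr_ge0_le0 eta0 obt; move: h.
rewrite !fdotE (fdotC P X) (fdotC H X) (fdotC H P).
move: (fdot X X) (fdot X P) (fdot P P) (fdot X H) (fdot P H) => a b c e g.
nra.
Qed.

Lemma fdot_specset_self : fdot X X <= zeta ^+ 2 * d%:R.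
Proof.
have := specset_norm 1%:M (ltW tau_gt0) (ltW zeta_gt0) X_spec.
by rewrite mulmx1 fdot_scalar mulr1 mul1r.
Qed.

End OneStep.

(** * The step in expectation *)

Section MatrixValuedMeasurable.
Context {R : realType} {dS : measure_display} {S : measurableType dS}.

Definition mx_measurable m n (F : S -> 'M[R]_(m, n)) :=
  forall i j, measurable_fun setT (fun w => F w i j).

Lemma mx_measurable_cst m n (A : 'M[R]_(m, n)) : mx_measurable (fun=> A).
Proof. by move=> i j; exact: measurable_cst. Qed.

Lemma mx_measurable_tr m n (F : S -> 'M[R]_(m, n)) : mx_measurable F ->
  mx_measurable (fun w => (F w)^T).
Proof. by move=> mF i j; under eq_fun do rewrite mxE; exact: mF. Qed.

Lemma mx_measurable_mul m n p (F : S -> 'M[R]_(m, n)) (G : S -> 'M[R]_(n, p)) :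
  mx_measurable F -> mx_measurable G -> mx_measurable (fun w => F w *m G w).
Proof.
move=> mF mG i j; under eq_fun do rewrite mxE.
by apply: measurable_sum => k; exact: measurable_funM.
Qed.

Lemma mx_measurable_add m n (F G : S -> 'M[R]_(m, n)) :
  mx_measurable F -> mx_measurable G -> mx_measurable (fun w => F w + G w).
Proof.
by move=> mF mG i j; under eq_fun do rewrite mxE; exact: measurable_funD.
Qed.

Lemma mx_measurable_scale m n (f : S -> R) (F : S -> 'M[R]_(m, n)) :
  measurable_fun setT f -> mx_measurable F ->
  mx_measurable (fun w => f w *: F w).
Proof.
by move=> mf mF i j; under eq_fun do rewrite mxE; exact: measurable_funM.
Qed.

Lemma mx_measurable_sub m n (F G : S -> 'M[R]_(m, n)) :
  mx_measurable F -> mx_measurable G -> mx_measurable (fun w => F w - G w).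
Proof.
by move=> mF mG i j; under eq_fun do rewrite !mxE; exact: measurable_funB.
Qed.

Lemma measurable_fdot m n (F G : S -> 'M[R]_(m, n)) :
  mx_measurable F -> mx_measurable G ->
  measurable_fun setT (fun w => fdot (F w) (G w)).
Proof.
move=> mF mG; apply: measurable_sum => i; apply: measurable_sum => j.
exact: measurable_funM.
Qed.

Lemma measurable_mxtrace n (F : S -> 'M[R]_n) :
  mx_measurable F -> measurable_fun setT (fun w => \tr (F w)).
Proof. by move=> mF; apply: measurable_sum => i; exact: mF. Qed.

Context {d : nat}.
Variables (tau zeta : R).
Hypotheses (tau_gt0 : 0 < tau) (tau_le_zeta : tau <= zeta).

Lemma mx_measurable_proj (X : S -> 'M[R]_d) : mx_measurable X ->
  mx_measurable (fun w => proj_prec tau zeta (X w)).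
Proof.
move=> mX i j.
apply: (continuous_measurable_mx mX (f := fun A => proj_prec tau zeta A i j)).
exact: proj_prec_continuous.
Qed.

Lemma proj_prec_id (X : 'M[R]_d) : specset tau zeta X -> proj_prec tau zeta X =
  X.
Proof.
move=> hX; have := proj_prec_closer tau_gt0 tau_le_zeta X hX.
have /eqP -> : fdot (X - X) (X - X) == 0 by rewrite fdot_eq0 subrr.
by move=> h; apply/eqP; rewrite -subr_eq0 -fdot_eq0 eq_le h fdot_ge0.
Qed.

Lemma mx_measurable_root (X : S -> 'M[R]_d) : mx_measurable X ->
  (forall w, specset tau zeta (X w)) ->
  mx_measurable (fun w => mines_root (X w)).
Proof.
move=> mX hX i j.
have -> : (fun w => mines_root (X w) i j) =
    fun w => sqrtmx (invmx (proj_prec tau zeta (X w))) i j.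
  by apply/funext => w; rewrite proj_prec_id.
apply: (continuous_measurable_mx mX
  (f := fun A => sqrtmx (invmx (proj_prec tau zeta A)) i j)).
exact: sqrtmx_invmx_proj_continuous.
Qed.

Lemma mx_measurable_invroot (X : S -> 'M[R]_d) : mx_measurable X ->
  (forall w, specset tau zeta (X w)) ->
  mx_measurable (fun w => mines_invroot (X w)).
Proof.
by move=> mX hX; apply: mx_measurable_mul => //; exact: mx_measurable_root.
Qed.

Lemma mx_measurable_W (H : 'M[R]_d) (X : S -> 'M[R]_d) (u : S -> 'cV[R]_d) :
  mx_measurable X -> (forall w, specset tau zeta (X w)) -> mx_measurable u ->
  mx_measurable (fun w => mines_W H (X w) (u w)).
Proof.
move=> mX hX mu; have mS := mx_measurable_root mX hX.
have mQ := mx_measurable_invroot mX hX.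
apply: mx_measurable_scale.
  apply: measurable_funM; first exact: measurable_cst.
  apply: measurable_fdot => //; apply: mx_measurable_mul => //.
  apply: mx_measurable_mul => //; apply: mx_measurable_mul => //.
apply: mx_measurable_sub => //; do 2 apply: mx_measurable_mul => //.
by apply: mx_measurable_mul => //; exact: mx_measurable_tr.
Qed.

End MatrixValuedMeasurable.

(** The normalization 1 / (2 alpha^2) cancels the alpha^2 of the second difference, leaving the
    factor 1 / 2 of [mines_W] and no trace of the point m. *)
Lemma mines_GE (R : realType) (d : nat) (alpha tau zeta : R)
    (f : 'cV[R]_d -> R) (H : 'M[R]_d) m (Sigma : 'M[R]_d) u :
  0 < alpha -> 0 < tau -> tau <= zeta ->
  (forall x v t, f (x - t *: v) + f (x + t *: v) - 2 * f x =
     t ^+ 2 * fdot v (H *m v)) ->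
  specset tau zeta (invmx Sigma) ->
  mines_G alpha f m Sigma u = mines_W H (invmx Sigma) u - invmx Sigma.
Proof.
move=> a0 t0 tz fH hX; rewrite /mines_G fH /mines_W; congr (_ *: _ - _).
  rewrite mulrA invfM mulfVK ?expf_neq0 ?gt_eqF//; congr (_ * _).
  rewrite fdot_mull -{1}(invmxK Sigma) (mines_root_sym t0 tz hX).
  by rewrite !mulmxA /mines_root invmxK.
by rewrite !(mines_invrootE t0 tz hX) /mines_root invmxK !mulmxA.
Qed.

Lemma entry_bound (R : realType) m n (A : 'M[R]_(m, n)) (c : R) i j :
  fdot A A <= c -> `|A i j| <= Num.sqrt c.
Proof.
move=> hA; have h := le_trans (entry_sqr_le_fdot A i j) hA.
by rewrite -sqrtr_sqr ler_sqrt// (le_trans (sqr_ge0 _) h).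
Qed.

Lemma fdot_scale_le (R : realType) m n (A : 'M[R]_(m, n)) (a z s : R) :
  fdot A A <= z ^+ 2 * s -> fdot (a *: A) (a *: A) <= (`|a| * z) ^+ 2 * s.
Proof.
move=> hA; rewrite fdotZl fdotZr mulrA -expr2.
have -> : (`|a| * z) ^+ 2 * s = a ^+ 2 * (z ^+ 2 * s).
  by rewrite exprMn real_normK ?num_real// mulrA.
exact: ler_wpM2l (sqr_ge0 a) _ _ hA.
Qed.

Lemma conj_symmx (R : realType) d (Q A : 'M[R]_d) :
  Q^T = Q -> A^T = A -> (Q *m A *m Q)^T = Q *m A *m Q.
Proof. by move=> sQ sA; rewrite !trmx_mul sQ sA mulmxA. Qed.

Lemma lincomb_symmx (R : realType) d (a b : R) (A B : 'M[R]_d) :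
  A^T = A -> B^T = B -> (a *: A - b *: B)^T = a *: A - b *: B.
Proof. by move=> sA sB; rewrite linearB/= !linearZ/= sA sB. Qed.

(** Flattens the sum to a single finite index type, the shape that [random_coef_mean] expects. *)
Lemma sum_quadruple (R : realType) (I : finType) (F : I -> I -> I -> I -> R) :
  \sum_a \sum_b \sum_c \sum_e F a b c e =
  \sum_(z : (I * I) * (I * I)) F z.1.1 z.1.2 z.2.1 z.2.2.
Proof.
rewrite pair_bigA/= [RHS](eq_bigr (fun z => (fun p q : I * I => F p.1 p.2 q.1
  q.2) z.1 z.2))//.
rewrite -(pair_bigA _ (fun p q : I * I => F p.1 p.2 q.1 q.2))/=.
by apply: eq_bigr => p _; rewrite pair_bigA.
Qed.

(** * The error recursion in expectation *)

Section ExpectedStep.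
Context {R : realType} {dS : measure_display} {S : measurableType dS} {d : nat}.
Variables (P : probability S R) (u : S -> 'cV[R]_d) (G : set (set S)).
Hypothesis u_gauss : std_gaussian P u.
Hypothesis G_measurable : G `<=` measurable.
Hypothesis G_indep : forall s A C, <<s G >> A -> measurable C ->
  P (A `&` word u s @^-1` C) = (P A * P (word u s @^-1` C))%E.
Variables (tau zeta L eta : R) (H : 'M[R]_d) (X : S -> 'M[R]_d).
Hypotheses (tau_gt0 : 0 < tau) (tau_le_zeta : tau <= zeta) (eta_ge0 : 0 <= eta).
Hypothesis H_spec : specset 0 L H.
Hypothesis mX : mx_measurable (X : g_sigma_algebraType G -> 'M[R]_d).
Hypothesis X_spec : forall w, specset tau zeta (X w).

Let zeta_ge0 : 0 <= zeta. Proof. by rewrite (le_trans _ tau_le_zeta)// ltW. Qed.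
Let Pi := proj_prec tau zeta H.
Let Pi_spec : specset tau zeta Pi := proj_prec_in tau_gt0 tau_le_zeta H.
Let C w := (2 * eta - 2 * eta ^+ 2) *: X w - (2 * eta) *: Pi.
Let B w := mines_root (X w) *m H *m mines_root (X w).
Let K w := mines_invroot (X w) *m C w *m mines_invroot (X w).
Let err w := fdot (X w - Pi) (X w - Pi).

Let mC : mx_measurable (C : g_sigma_algebraType G -> 'M[R]_d).
Proof.
apply: mx_measurable_sub; last exact: mx_measurable_cst.
by apply: mx_measurable_scale => //; exact: measurable_cst.
Qed.

Let mB : mx_measurable (B : g_sigma_algebraType G -> 'M[R]_d).
Proof.
have mS := mx_measurable_root tau_gt0 tau_le_zeta mX X_spec.
do 2 apply: mx_measurable_mul => //; exact: mx_measurable_cst.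
Qed.

Let mK : mx_measurable (K : g_sigma_algebraType G -> 'M[R]_d).
Proof.
have mQ := mx_measurable_invroot tau_gt0 tau_le_zeta mX X_spec.
by do 2 apply: mx_measurable_mul => //.
Qed.

Let C_bound w : fdot (C w) (C w) <=
  (`|2 * eta - 2 * eta ^+ 2| * zeta + 2 * eta * zeta) ^+ 2 * d%:R.
Proof.
have n2 : 2 * eta = `|- (2 * eta)| by rewrite normrN ger0_norm ?mulr_ge0.
have hX := fdot_scale_le (2 * eta - 2 * eta ^+ 2)
  (fdot_specset_self tau_gt0 tau_le_zeta (X_spec w)).
have := fdot_scale_le (- (2 * eta)) (fdot_specset_self tau_gt0 tau_le_zeta
  Pi_spec).
rewrite -n2 scaleNr => hP. apply: (fdot_add_le _ _ _ hX hP); rewrite ?ler0n//.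
  by rewrite mulr_ge0.
by rewrite !mulr_ge0.
Qed.

(** Crude constants: they only certify integrability and do not enter the final estimate. *)
Let c0 := (`|2 * eta - 2 * eta ^+ 2| * zeta + 2 * eta * zeta) ^+ 2 * d%:R.
Let b := Num.sqrt (tau^-1 ^+ 2 * fdot H H).
Let k := Num.sqrt (zeta ^+ 2 * c0).

Let B_bound w i j : `|B w i j| <= b.
Proof. by apply: entry_bound; exact: (mines_root_bound2 tau_gt0 tau_le_zeta
  (X_spec w)). Qed.

Let K_bound w i j : `|K w i j| <= k.
Proof.
apply: entry_bound.
rewrite (le_trans (mines_invroot_bound2 tau_gt0 tau_le_zeta (X_spec w) _))//.
by rewrite ler_wpM2l ?sqr_ge0.
Qed.

Let trK_bound w : `|\tr (K w)| <= k *+ d.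
Proof.
rewrite (le_trans (ler_norm_sum _ _ _))// -[X in _ <= _ *+ X]card_ord
  -sumr_const.
by apply: ler_sum.
Qed.

Let coef4 (z : ('I_d * 'I_d) * ('I_d * 'I_d)) w :=
  2^-1 * (B w z.1.1 z.1.2 * K w z.2.1 z.2.2).
Let word4 (z : ('I_d * 'I_d) * ('I_d * 'I_d)) :=
  [:: z.1.1; z.1.2; z.2.1; z.2.2].
Let coef2 (z : 'I_d * 'I_d) w := - (2^-1 * (\tr (K w) * B w z.1 z.2)).
Let word2 (z : 'I_d * 'I_d) := [:: z.1; z.2].

Let fdot_CW w : fdot (C w) (mines_W H (X w) (u w)) =
  \sum_z coef4 z w * word u (word4 z) w + \sum_z coef2 z w * word u (word2 z) w.
Proof.
rewrite (fdot_mines_W H tau_gt0 tau_le_zeta (X_spec w)) -/(B w) -/(K w).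
rewrite !quad_formE mulrBr; congr (_ + _).
  rewrite -(sum_quadruple (fun a b c e => 2^-1 * (B w a b * K w c e) *
    word u [:: a; b; c; e] w)).
  rewrite mulr_suml mulr_sumr; apply: eq_bigr => a0 _.
  rewrite mulr_suml mulr_sumr; apply: eq_bigr => b0 _.
  rewrite !mulr_sumr; apply: eq_bigr => c1 _.
  rewrite !mulr_sumr; apply: eq_bigr => e0 _.
  by rewrite /word !big_cons big_nil mulr1; ring.
rewrite -(pair_bigA _ (fun a b => - (2^-1 * (\tr (K w) * B w a b)) *
    word u [:: a; b] w))/=.
rewrite !mulr_sumr -sumrN; apply: eq_bigr => a0 _.
rewrite !mulr_sumr -sumrN; apply: eq_bigr => b0 _.
by rewrite /word !big_cons big_nil mulr1; ring.
Qed.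

(** Symmetry makes the two cross pairings of Isserlis' formula equal, so that the factor 1 / 2
    leaves exactly one of them. *)
Let K_sym w : (K w)^T = K w.
Proof.
apply: conj_symmx (mines_invroot_sym tau_gt0 tau_le_zeta (X_spec w)) _.
exact: lincomb_symmx (specset_sym (X_spec w)) (specset_sym Pi_spec).
Qed.

(** The products of traces coming from the degree 4 and degree 2 parts cancel. What remains is <S H
    S, Q C Q>, in which the conjugations undo each other. *)
Let mean_CW w :
  \sum_z coef4 z w * wick (word4 z) + \sum_z coef2 z w * wick (word2 z) =
  fdot (C w) H.
Proof.
have -> : \sum_z coef4 z w * wick (word4 z) =
    2^-1 * (\tr (B w) * \tr (K w) + fdot (B w) (K w) + fdot (B w) (K w)^T).
  rewrite -sum_wick4 sum_quadruple mulr_sumr; apply: eq_bigr => z _.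
  by rewrite /coef4 !mulrA.
have -> : \sum_z coef2 z w * wick (word2 z) = - (2^-1 * (\tr (K w) * \tr (B
  w))).
  rewrite -(sum_wick2 (B w)) pair_bigA/= !mulr_sumr -sumrN;
    apply: eq_bigr => z _.
  by rewrite /coef2 mulNr !mulrA.
rewrite K_sym -(fdot_root_conj H tau_gt0 tau_le_zeta (X_spec w) (C w)) -/(B w)
  -/(K w).
by field.
Qed.

Let m_coef4 z : measurable_fun setT (coef4 z : g_sigma_algebraType G -> R).
Proof.
apply: measurable_funM; first exact: measurable_cst.
by apply: measurable_funM; [exact: mB|exact: mK].
Qed.

Let m_coef2 z : measurable_fun setT (coef2 z : g_sigma_algebraType G -> R).
Proof.
apply: measurableT_comp => //.
apply: measurable_funM; first exact: measurable_cst.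
by apply: measurable_funM; [exact: measurable_mxtrace|exact: mB].
Qed.

Let coef4_bound z w : `|coef4 z w| <= 2^-1 * (b * k).
Proof.
by rewrite !normrM ger0_norm ?invr_ge0// ler_wpM2l ?invr_ge0// ler_pM.
Qed.

Let coef2_bound z w : `|coef2 z w| <= 2^-1 * (k *+ d * b).
Proof.
by rewrite normrN !normrM ger0_norm ?invr_ge0// ler_wpM2l ?invr_ge0// ler_pM.
Qed.

Let past_integrable (f : S -> R) c :
  measurable_fun setT (f : g_sigma_algebraType G -> R) ->
  (forall w, `|f w| <= c) -> P.-integrable setT (EFin \o f).
Proof.
by move=> mf; apply: bounded_integrable; exact: sub_sigma_measurable mf.
Qed.

Lemma expected_inner :
  P.-integrable setT (EFin \o (fun w => fdot (C w) (mines_W H (X w) (u w)))) /\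
  \int[P]_w fdot (C w) (mines_W H (X w) (u w)) = \int[P]_w fdot (C w) H.
Proof.
have [i4 e4] := random_coef_mean u_gauss G_measurable G_indep word4 m_coef4
  coef4_bound.
have [i2 e2] := random_coef_mean u_gauss G_measurable G_indep word2 m_coef2
  coef2_bound.
have -> : (fun w => fdot (C w) (mines_W H (X w) (u w))) = fun w =>
   \sum_z coef4 z w * word u (word4 z) w + \sum_z coef2 z w * word u (word2 z)
     w.
  by apply/funext => w; exact: fdot_CW.
split; first exact: (integrableD measurableT i4 i2).
have -> : (fun w => fdot (C w) H) = fun w =>
   \sum_z coef4 z w * wick (word4 z) + \sum_z coef2 z w * wick (word2 z).
  by apply/funext => w; rewrite mean_CW.
have [j4 _] := Rintegral_sum (index_enum _) (fun z => integrableZr measurableT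
  (wick (word4 z)) (past_integrable (m_coef4 z) (coef4_bound z))).
have [j2 _] := Rintegral_sum (index_enum _) (fun z => integrableZr measurableT
  (wick (word2 z)) (past_integrable (m_coef2 z) (coef2_bound z))).
by rewrite !RintegralD// e4 e2.
Qed.

Let q w := fdot (u w) (u w) ^+ 2 * (fdot (u w) (u w) ^+ 2 - 2 * fdot (u w) (u w)
  + d%:R).

(** The moments of |u|^2 give d (d + 2) (d + 4) (d + 6) - 2 d (d + 2) (d + 4) + d^2 (d + 2), which
    expands to the polynomial in the theorem. *)
Lemma expected_quartic : P.-integrable setT (EFin \o q) /\
  \int[P]_w q w =
    d%:R ^+ 4 + 11 * d%:R ^+ 3 + 34 * d%:R ^+ 2 + 32 * d%:R.
Proof.
have mom n : P.-integrable setT (EFin \o (fun w => fdot (u w) (u w) ^+ n)) /\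
    \int[P]_w (fdot (u w) (u w) ^+ n) = \prod_(j < n) (d + 2 * j)%:R.
  have [h1 h2] := normsq_word_moment u_gauss n [::].
  have e : (fun w => fdot (u w) (u w) ^+ n * word u [::] w) =
      fun w => fdot (u w) (u w) ^+ n.
    by apply/funext => w; rewrite /word big_nil mulr1.
  rewrite e in h1 h2; split; first exact: h1.
  by rewrite h2 wick_nil mulr1 addn0.
have [i4 e4] := mom 4%N; have [i3 e3] := mom 3%N; have [i2 e2] := mom 2%N.
have i3' := integrableZl measurableT (- 2) i3.
have i2' := integrableZl measurableT d%:R i2.
have i32 := integrableD measurableT i3' i2'.
have -> : q = fun w => fdot (u w) (u w) ^+ 4 +
    (- 2 * fdot (u w) (u w) ^+ 3 + d%:R * fdot (u w) (u w) ^+ 2).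
  by apply/funext => w; rewrite /q; ring.
split; first exact: (integrableD measurableT i4 i32).
rewrite RintegralD// RintegralD// !RintegralZl// e4 e3 e2 !big_ord_recl
  !big_ord0/=.
by rewrite /bump/= !natrD; ring.
Qed.

Let X' w := proj_prec tau zeta (X w + eta *: (mines_W H (X w) (u w) - X w)).
Let err' w := fdot (X' w - Pi) (X' w - Pi).

Hypothesis mX' : mx_measurable X'.

Lemma expected_step :
  \int[P]_w err' w <= (1 - 2 * eta) * (\int[P]_w err w) +
    eta ^+ 2 * (L ^+ 2 * zeta ^+ 2 / (4 * tau ^+ 2)
      * (d%:R ^+ 4 + 11 * d%:R ^+ 3 + 34 * d%:R ^+ 2 + 32 * d%:R)
      + d%:R * zeta ^+ 2).
Proof.
set M := L ^+ 2 * zeta ^+ 2 / (4 * tau ^+ 2).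
have t0 := ltW tau_gt0.
have [iW eW] := expected_inner; have [iq eq] := expected_quartic.
have mXP : mx_measurable (fun w : g_sigma_algebraType G => X w - Pi).
  by apply: mx_measurable_sub => //; exact: mx_measurable_cst.
have errC w : `|err w| <= zeta ^+ 2 * d%:R.
  by rewrite ger0_norm ?fdot_ge0// (specset_dist t0 tau_le_zeta).
have ierr : P.-integrable setT (EFin \o err).
  by apply: past_integrable errC; exact: measurable_fdot.
have ierr' : P.-integrable setT (EFin \o err').
  apply: (@bounded_integrable _ _ _ _ _ (zeta ^+ 2 * d%:R)) => [|w].
    by apply: measurable_fdot; apply: mx_measurable_sub => //;
      exact: mx_measurable_cst.
  rewrite ger0_norm ?fdot_ge0// (specset_dist t0 tau_le_zeta)//.
  exact: proj_prec_in.
pose r w := - (2 * eta) * fdot (X w - Pi) (X w).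
have ir : P.-integrable setT (EFin \o r).
  apply: (@past_integrable _ (2 * eta * (zeta ^+ 2 * d%:R))).
    by apply: measurable_funM; [exact: measurable_cst|exact: measurable_fdot].
  move=> w; rewrite /r normrM normrN [`|2 * eta|]ger0_norm ?mulr_ge0//.
  rewrite ler_wpM2l ?mulr_ge0//.
  rewrite -(@ler_pXn2r _ 2) ?nnegrE ?mulr_ge0 ?sqr_ge0// real_normK ?num_real//.
  rewrite (le_trans (fdot_cauchy _ _))// (expr2 (_ * _)) ler_pM ?fdot_ge0//.
    exact: specset_dist t0 tau_le_zeta (X_spec w) Pi_spec.
  exact: (fdot_specset_self tau_gt0 tau_le_zeta (X_spec w)).
have iCH : P.-integrable setT (EFin \o (fun w => fdot (C w) H)).
  apply: (@past_integrable _ (Num.sqrt (c0 * fdot H H))).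
    by apply: measurable_fdot => //; exact: mx_measurable_cst.
  move=> w; rewrite -sqrtr_sqr ler_wsqrtr// (le_trans (fdot_cauchy _ _))//.
  by rewrite ler_wpM2r ?fdot_ge0.
have icst (x : R) : P.-integrable setT (EFin \o cst x).
  exact: finite_measure_integrable_cst.
have ecst (x : R) : \int[P]_w cst x w = x.
  rewrite Rintegral_cst//; have -> : fine (P [set: S]) = 1.
    exact: (congr1 fine (probability_setT P)).
  by rewrite mulr1.
pose D : R := eta ^+ 2 * (d%:R * zeta ^+ 2).
have iMq := integrableZl measurableT (eta ^+ 2 * M) iq.
have iA := integrableD measurableT ierr ir.
have iAW := integrableD measurableT iA iW.
have iAH := integrableD measurableT iA iCH.
have iMD := integrableD measurableT iMq (icst D).
(* The expansion is pointwise, but <C, W> may be exchanged for <C, H> only under the integral. Hence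
   one pointwise comparison before the exchange and another after it. *)
apply: (@le_trans _ _ (\int[P]_w ((err w + r w + fdot (C w) (mines_W H (X w) (u
  w)))
   + (eta ^+ 2 * M * q w + cst D w)))).
  apply: le_Rintegral => //; first exact: (integrableD measurableT iAW iMD).
  move=> w _; rewrite /err' /X'.
  apply: le_trans (proj_prec_closer tau_gt0 tau_le_zeta _ Pi_spec) _.
  rewrite (@mines_step_expand _ _ (X w) Pi (C w))//; apply: lerD.
    by rewrite /r mulNr.
  rewrite /D /cst -(mulrA (eta ^+ 2)) -mulrDr ler_wpM2l ?sqr_ge0// lerD//.
    exact: (mines_W_bound tau_gt0 tau_le_zeta H_spec (X_spec w)).
  by rewrite mulrC (fdot_specset_self tau_gt0 tau_le_zeta (X_spec w)).
rewrite (RintegralD measurableT iAW iMD).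
have -> : \int[P]_w (eta ^+ 2 * M * q w + cst D w) = eta ^+ 2 * M *
    (d%:R ^+ 4 + 11 * d%:R ^+ 3 + 34 * d%:R ^+ 2 + 32 * d%:R) + D.
  by rewrite (RintegralD measurableT iMq (icst D)) ecst RintegralZl// eq.
have -> : \int[P]_w (err w + r w + fdot (C w) (mines_W H (X w) (u w))) =
    \int[P]_w (err w + r w + fdot (C w) H).
  by rewrite (RintegralD measurableT iA iW) eW (RintegralD measurableT iA iCH).
rewrite /D -mulrA -mulrDr lerD2r -RintegralZl//.
apply: le_Rintegral => //; first exact: (integrableZl measurableT (1 - 2 * eta)
  ierr).
move=> w _; rewrite /r mulNr.
exact: (mines_mean_decrease tau_gt0 tau_le_zeta H_spec (X_spec w)).
Qed.

End ExpectedStep.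

(** * The sigma-algebra of the past draws *)

Section Past.
Context {R : realType} {dT : measure_display} {T : measurableType dT} {d : nat}.
Variable u : nat -> T -> 'cV[R]_d.

(** The generating family of [sigma_generated u J], kept apart from its closure so that it can index
    [g_sigma_algebraType]. *)
Definition past (J : set nat) : set (set T) :=
  \bigcup_(j in J) \bigcup_(i in [set: 'I_d])
    preimage_set_system setT (fun w => u j w i ord0) measurable.

Lemma coord_past_measurable J j i : J j ->
  measurable_fun setT ((fun w => u j w i ord0) : g_sigma_algebraType (past J) ->
    R).
Proof.
move=> Jj _ B mB; apply: sub_sigma_algebra; exists j => //; exists i => //.
by exists B.
Qed.

Lemma past_measurable_subset J J' (f : T -> R) : J `<=` J' ->
  measurable_fun setT (f : g_sigma_algebraType (past J) -> R) ->
  measurable_fun setT (f : g_sigma_algebraType (past J') -> R).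
Proof.
move=> JJ' mf _ B mB; have := mf measurableT _ mB.
apply: (smallest_sub (@smallest_sigma_algebra _ setT (past J'))).
move=> A [j Jj Aj]; apply: sub_sigma_algebra; exists j => //; exact: JJ'.
Qed.

Lemma past_sub_measurable J :
  (forall j i, J j -> measurable_fun setT (fun w => u j w i ord0)) ->
  past J `<=` measurable.
Proof.
by move=> mu _ [j Jj [i _ [B mB <-]]]; exact: mu.
Qed.

Lemma word_preimage_past J j s C : J j -> measurable C ->
  <<s past J>> (word (u j) s @^-1` C).
Proof.
move=> Jj mC.
have mw : measurable_fun setT (word (u j) s : g_sigma_algebraType (past J) ->
  R).
  by apply: measurable_prod => i _; exact: coord_past_measurable.
by have := mw measurableT _ mC; rewrite setTI.
Qed.

End Past.

(** * The recursion along a trajectory *)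

Theorem theorem5 (R : realType) (d : nat) (alpha tau zeta L sigma : R)
  (f : 'cV[R]_d -> R) (H : 'M[R]_d)
  (dT : measure_display) (T : measurableType dT) (P : probability T R)
  (u : nat -> T -> 'cV[R]_d) (eta1 : nat -> R)
  (mu1 : 'cV[R]_d) (Sigma1 : 'M[R]_d)
  (mu : nat -> T -> 'cV[R]_d) (Sigma : nat -> T -> 'M[R]_d)
  (alpha_gt0 : 0 < alpha) (tau_gt0 : 0 < tau) (tau_le_zeta : tau <= zeta)
  (sigma_gt0 : 0 < sigma)
  (f_quadratic : quadratic f) (f_hessian : forall x, hessian f x = H)
  (f_smooth : lsmooth L f) (f_convex : strongly_convex sigma f)
  (u_gaussian : forall k, (1 <= k)%N -> std_gaussian P (u k))
  (u_indep : forall k, (1 <= k)%N -> indep_of_past P u k)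
  (eta1_gt0 : forall k, (1 <= k)%N -> 0 < eta1 k)
  (Sigma1_S : covset tau zeta Sigma1)
  (mines_run : forall w, mines alpha tau zeta f eta1 (fun k => k%:R^-1)
     mu1 Sigma1 (fun k => u k w) (fun k => mu k w) (fun k => Sigma k w))
  (k : nat) (k_ge1 : (1 <= k)%N) :
  ('E_P[fun w =>
      (frobenius (invmx (Sigma k w) - proj_prec tau zeta H) ^+ 2)%R]
   <= (k%:R^-1 *
       Num.max (frobenius (invmx Sigma1 - H) ^+ 2)
         (L ^+ 2 * zeta ^+ 2 / (4 * tau ^+ 2)
            * (d%:R ^+ 4 + 11 * d%:R ^+ 3 + 34 * d%:R ^+ 2 + 32 * d%:R)
          + 2 * d%:R * zeta ^+ 2 + frobenius H ^+ 2))%:E)%E.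
Proof.
have [H_spec fdiff] :=
  quadratic_hessian_specset sigma_gt0 f_quadratic f_hessian f_smooth f_convex.
pose X n w := invmx (Sigma n w).
pose Pi := proj_prec tau zeta H.
have Pi_spec : specset tau zeta Pi := proj_prec_in tau_gt0 tau_le_zeta H.
have X1 w : X 1%N w = invmx Sigma1 by rewrite /X; have [_ -> _] := mines_run w.
have X1_spec : specset tau zeta (invmx Sigma1).
  by rewrite -(precsetE tau_gt0 tau_le_zeta); exists Sigma1.
have X_spec n w : (1 <= n)%N -> specset tau zeta (X n w).
  case: n => // -[_|n _]; first by rewrite X1.
  by rewrite /X; have [_ _ /(_ n.+1 isT) [_ ->]] := mines_run w;
    exact: proj_prec_in.
have X_step n w : (1 <= n)%N -> X n.+1 w =
    proj_prec tau zeta (X n w + n%:R^-1 *: (mines_W H (X n w) (u n w) - X n w)).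
  move=> n1; rewrite {1}/X; have [_ _ /(_ n n1) [_ ->]] := mines_run w.
  by rewrite (mines_GE _ _ alpha_gt0 tau_gt0 tau_le_zeta fdiff)//;
    exact: X_spec.
pose before n := [set j | (1 <= j < n)%N].
(* X n depends on the draws 1, ..., n - 1 only. Thus X 1 is constant, and the passage from n + 1 to
   n + 2 brings in the draw n + 1. *)
have mX n : (1 <= n)%N ->
    mx_measurable (X n : g_sigma_algebraType (past u (before n)) -> 'M[R]_d).
  elim: n => // -[_ _|n IH _].
    have -> : X 1%N = fun=> invmx Sigma1 by apply/funext => w; exact: X1.
    exact: mx_measurable_cst.
  have mXn : mx_measurable
      (X n.+1 : g_sigma_algebraType (past u (before n.+2)) -> 'M[R]_d).
    move=> i j; apply: past_measurable_subset (IH isT i j) => l /= /andP[l1 ln].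
    by apply/andP; split; rewrite ?l1// ltnW.
  have mun : mx_measurable
      (u n.+1 : g_sigma_algebraType (past u (before n.+2)) -> 'cV[R]_d).
    move=> i j; rewrite (ord1 j); apply: coord_past_measurable.
    by apply/andP; split.
  have -> : X n.+2 = fun w => proj_prec tau zeta (X n.+1 w +
      n.+1%:R^-1 *: (mines_W H (X n.+1 w) (u n.+1 w) - X n.+1 w)).
    by apply/funext => w; exact: X_step.
  apply: mx_measurable_proj => //; apply: mx_measurable_add => //.
  apply: mx_measurable_scale; first exact: measurable_cst.
  apply: mx_measurable_sub => //.
  by apply: (mx_measurable_W tau_gt0 tau_le_zeta) => // w; exact: X_spec.
have past_meas n : past u (before n) `<=` measurable.
  apply: past_sub_measurable => j i /= /andP[j1 _].
  by have [] := u_gaussian j j1.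
have mXT n : (1 <= n)%N -> mx_measurable (X n).
  by move=> n1 i j; exact: (sub_sigma_measurable (past_meas n) (mX n n1 i j)).
pose err n w := fdot (X n w - Pi) (X n w - Pi).
pose a n := \int[P]_w err n w.
pose q : R := d%:R ^+ 4 + 11 * d%:R ^+ 3 + 34 * d%:R ^+ 2 + 32 * d%:R.
pose c := L ^+ 2 * zeta ^+ 2 / (4 * tau ^+ 2).
have a_step n : (1 <= n)%N -> a n.+1 <= (1 - 2 * n%:R^-1) * a n +
    n%:R^-1 ^+ 2 * (c * q + d%:R * zeta ^+ 2).
  move=> n1.
  have ind s A C : <<s past u (before n)>> A -> measurable C ->
      P (A `&` word (u n) s @^-1` C) = (P A * P (word (u n) s @^-1` C))%E.
    move=> sA mC; rewrite setIC muleC.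
    apply: (u_indep n n1 _ _ _ sA).
    exact: (@word_preimage_past _ _ _ _ u [set n] n s C erefl mC).
  have := @expected_step _ _ _ _ _ _ _ (u_gaussian n n1) (past_meas n) ind
     tau zeta L n%:R^-1 H (X n) tau_gt0 tau_le_zeta _ H_spec (mX n n1)
     (fun w => X_spec n w n1).
  rewrite invr_ge0 ler0n => /(_ isT).
  have e : X n.+1 = fun w => proj_prec tau zeta (X n w +
      n%:R^-1 *: (mines_W H (X n w) (u n w) - X n w)).
    by apply/funext => w; exact: X_step.
  by rewrite -e => /(_ (mXT _ (ltn0Sn n))); rewrite /a /err e.
have err_le n w : (1 <= n)%N -> err n w <= zeta ^+ 2 * d%:R.
  by move=> n1; apply: (specset_dist (ltW tau_gt0) tau_le_zeta) => //;
    exact: X_spec.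
have err_int n : (1 <= n)%N -> P.-integrable setT (EFin \o err n).
  move=> n1; apply: (@bounded_integrable _ _ _ _ _ (zeta ^+ 2 * d%:R)) => [|w].
    have mD := mx_measurable_sub (mXT n n1) (@mx_measurable_cst _ _ _ _ _ Pi).
    exact: (measurable_fdot mD mD).
  by rewrite ger0_norm ?fdot_ge0// err_le.
have P1 : fine (P setT) = 1 by exact: (congr1 fine (probability_setT P)).
set M := L ^+ 2 * zeta ^+ 2 / _ * _ + _ + _.
set E1 := frobenius (invmx Sigma1 - H) ^+ 2.
have cst_int (x : R) : P.-integrable setT (EFin \o cst x).
  exact: finite_measure_integrable_cst.
have q0 : 0 <= q by rewrite /q !addr_ge0// ?mulr_ge0 ?exprn_ge0.
have c0 : 0 <= c.
  by rewrite /c divr_ge0// mulr_ge0// sqr_ge0.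
have dz0 : 0 <= d%:R * zeta ^+ 2 by rewrite mulr_ge0 ?sqr_ge0.
(* Only three properties of the maximum are used: [M1] bounds the additive term of the recursion,
   [M2] settles k = 2, and [M3] settles k = 1. *)
have M1 : c * q + d%:R * zeta ^+ 2 <= Num.max E1 M.
  rewrite le_max; apply/orP; right; rewrite /M -/c -/q -mulrA -addrA lerD2l.
  by have := sqr_ge0 (frobenius H); lra.
have M2 : 2 * (d%:R * zeta ^+ 2) <= Num.max E1 M.
  rewrite le_max; apply/orP; right; rewrite /M -/c -/q -mulrA.
  by have := sqr_ge0 (frobenius H); have := mulr_ge0 c0 q0; lra.
have M3 : E1 <= Num.max E1 M by rewrite le_max lexx.
move: (Num.max E1 M) M1 M2 M3 => Z M1 M2 M3.
suff a_le : forall n, (1 <= n)%N -> a n <= n%:R^-1 * Z.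
  (* The recursion is run on real integrals; returning to the extended expectation is sound because
     the error is bounded, hence integrable. *)
  have /= := a_le k k_ge1; rewrite -lee_fin; congr (_ <= _)%E.
  rewrite /a /Rintegral fineK; last exact: (integrable_fin_num measurableT
    (err_int k k_ge1)).
  by rewrite unlock; apply: eq_integral => w _; rewrite frobenius_sqr.
case=> // -[_|n _].
  rewrite invr1 mul1r (le_trans _ M3)//.
  apply: (@le_trans _ _ (\int[P]_w cst E1 w)).
    apply: le_Rintegral => //; first exact: err_int.
    move=> w _; rewrite /err X1 /E1 frobenius_sqr.
    (* The starting matrix lies in S', so projecting H brings it no farther from that matrix. The
       rewriting below only reverses the two differences. *)
    have := proj_prec_closer tau_gt0 tau_le_zeta H X1_spec; rewrite -/Pi.
    by rewrite -[X in fdot X X <= _]opprB fdotNl fdotNr opprK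
       -[X in _ <= fdot X X]opprB fdotNl fdotNr opprK.
  by rewrite Rintegral_cst// P1 mulr1.
elim: n => [|n IH].
  apply: (@le_trans _ _ (d%:R * zeta ^+ 2)); last by rewrite ler_pdivlMl.
  apply: (@le_trans _ _ (\int[P]_w cst (zeta ^+ 2 * d%:R) w)).
    by apply: le_Rintegral => //; [exact: err_int|move=> w _; exact: err_le].
  by rewrite Rintegral_cst// P1 mulr1 mulrC.
apply: le_trans (a_step n.+2 isT) _.
have n2 : (2 : R) <= n.+2%:R by rewrite ler_nat.
rewrite -[n.+3%:R]natr1; move: (n.+2%:R : R) n2 IH => x x2 IH.
have x0 : 0 < x by lra.
have Z0 : 0 <= Z by rewrite (le_trans _ M2)// mulr_ge0.
(* Here x = k >= 2, so the factor 1 - 2 / x is nonnegative and the induction hypothesis may be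
   inserted. *)
apply: (@le_trans _ _ ((1 - 2 * x^-1) * (x^-1 * Z) + x^-1 ^+ 2 * Z)).
  rewrite lerD ?ler_wpM2l ?sqr_ge0// subr_ge0 ler_pdivrMr//; lra.
(* The bound is now Z (x - 1) / x^2, which falls short of Z / (x + 1) by exactly Z / (x^2 (x +
   1)). *)
rewrite -subr_ge0.
have -> : (x + 1)^-1 * Z - ((1 - 2 * x^-1) * (x^-1 * Z) + x^-1 ^+ 2 * Z) =
    Z / (x ^+ 2 * (x + 1)).
  by field; apply/andP; split; lra.
by rewrite divr_ge0// mulr_ge0 ?sqr_ge0//; lra.
Qed.
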